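(* Let $(M,g,J_1,J_2,J_3)$ be a compact neutral hyperhermitian four-manifold with hyperbolic twistor space $\mathcal Z$ and let $p:\mathcal Z\to H$ be the natural projection. Then any $\mathcal J_1$-holomorphic function $f$ on $\mathcal Z$ has the form $f=\phi\circ p$ where $\phi$ is a holomorphic function on $H$. If $M$ is neutral hyperkähler, any $\mathcal J_2$-holomorphic function $f$ on $\mathcal Z$ has the form $f=\phi\circ p$ where $\phi$ is an anti-holomorphic function on $H$.
   Context: Manifolds $M$ are assumed connected. A neutral almost hyperhermitian four-manifold $(M,g,J_1,J_2,J_3)$ is a four-manifold $M$ with a pseudo-Riemannian metric $g$ of signature $(2,2)$ and globally defined endomorphism fields $J_1,J_2,J_3$ of $TM$ with $J_1^2=-\mathrm{Id}$, $J_2^2=J_3^2=\mathrm{Id}$, $J_1J_2=-J_2J_1=J_3$, compatible with $g$: $g(J_1X,J_1Y)=g(X,Y)$, $g(J_aX,J_aY)=-g(X,Y)$ for $a=2,3$. It is neutral hyperhermitian if $J_1,J_2,J_3$ are integrable (their Nijenhuis tensors vanish), and neutral hyperkähler if moreover $J_1,J_2,J_3$ are parallel for the Levi-Civita connection $D$ of $g$. Let $H=\{y=(y_1,y_2,y_3)\in\mathbb R^3: y_1^2-y_2^2-y_3^2=1\}$. The almost complex structures $J_y=y_1J_1+y_2J_2+y_3J_3$, $y\in H$, all induce the same orientation on $M$, and $M$ is taken with this orientation. Hyperbolic twistor space: it is $\pi:\mathcal Z\to M$, $\mathcal Z=\{\sigma=y_1J_1(x)+y_2J_2(x)+y_3J_3(x):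 x\in M,\ y\in H\}$, with $\pi(\sigma)=x$, contained in the rank $3$ bundle $E=\mathrm{span}(J_1,J_2,J_3)\subset\mathrm{End}(TM)$, which is preserved by $D$. Equip $E$ with the fibre metric $\langle\,,\rangle$ making $J_1,J_2,J_3$ orthogonal with $\langle J_1,J_1\rangle=-1$, $\langle J_2,J_2\rangle=\langle J_3,J_3\rangle=1$, and with the fibrewise bilinear antisymmetric vector product $J_1\times J_2=J_3$, $J_2\times J_3=-J_1$, $J_3\times J_1=J_2$. The connection $D$ splits $T\mathcal Z$ into horizontal and vertical parts; $X^h_\sigma$ is the horizontal lift of $X\in T_{\pi(\sigma)}M$, and the vertical space at $\sigma$ is $\mathcal V_\sigma=\{V\in E_{\pi(\sigma)}:\langle\sigma,V\rangle=0\}$. For $k=1,2$ the almost complex structure $\mathcal J_k$ on $\mathcal Z$ is $\mathcal J_kX^h_\sigma=(\sigma X)^h_\sigma$, $\mathcal J_kV=(-1)^{k-1}\sigma\times V$ for $V\in\mathcal V_\sigma$. The natural projection $p:\mathcal Z\to H$ is $p(\sigma)=(y_1,y_2,y_3)$ where $\sigma=y_1J_1(x)+y_2J_2(x)+y_3J_3(x)$. The hyperboloid $H$ carries the complex structure $SV=y\times V$, $V\in T_yH$, where $\times$ on $\mathbb R^3$ is the same product in the standard basis ($e_1\times e_2=e_3$, $e_2\times e_3=-e_1$, $e_3\times e_1=e_2$). A $C^\infty$ complex-valued function on an almost complex manifold is holomorphic if its differential is complex-linear with respect to the almost complex structure. *)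

(* Defs.v *)
From HB Require Import structures.
From mathcomp Require Import all_boot all_order all_algebra.
From mathcomp Require Import all_classical all_reals.
From mathcomp Require Import topology normedtype derive.
From mathcomp Require Import complex.

Set Implicit Arguments.
Unset Strict Implicit.
Unset Printing Implicit Defensive.

Import Order.TTheory GRing.Theory Num.Theory.
Import numFieldNormedType.Exports.

Local Open Scope classical_set_scope.
Local Open Scope ring_scope.

Section Calculus.
Variable R : realType.

Definition iter_derive (V W : normedModType R) (f : V -> W) (s : seq V) :
  V -> W := foldr (fun v h x => 'D_v h x) f s.

(* Only used for finite-dimensional V and open U, where it is the usual
   notion of a C^oo map: all iterated directional derivatives exist and are
   continuous. *)
Definition smooth_on (V W : normedModType R) (U : set V) (f : V -> W) : Prop :=
  forall (s : seq V) (x : V), U x ->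
    {for x, continuous (iter_derive f s)} /\
    forall v, derivable (iter_derive f s) x v.

Definition smoothC_on (V : normedModType R) (U : set V) (F : V -> R[i]) :=
  smooth_on U (fun x => complex.Re (F x)) /\
  smooth_on U (fun x => complex.Im (F x)).

Definition deriveC (V : normedModType R) (F : V -> R[i]) (x v : V) : R[i] :=
  ('D_v (fun z => complex.Re (F z)) x +i* 'D_v (fun z => complex.Im (F z)) x)%C.

(* S is an embedded submanifold of V with tangent spaces T x, and J x is an
   endomorphism of T x.  As usual, a function on S is smooth when it extends
   locally to a smooth function F on an open subset of V; its differential on
   T x is then the restriction of the differential of F, whatever F is. *)
Definition diff_scales_on (c : R[i]) (V : normedModType R) (S : set V)
    (T : V -> set V) (J : V -> V -> V) (f : V -> R[i]) : Prop :=
  forall x, S x -> exists (U : set V) (F : V -> R[i]),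
    [/\ open U, U x, smoothC_on U F,
        (forall z, U z -> S z -> F z = f z) &
        forall v, T x v -> deriveC F x (J x v) = c * deriveC F x v].

Definition holomorphic_on := diff_scales_on ('i)%C.
Definition antiholomorphic_on := diff_scales_on (- 'i)%C.

Definition jac (F : 'cV[R]_4 -> 'cV[R]_4) (u : 'cV[R]_4) : 'M[R]_4 :=
  \matrix_(a, b) ('D_(delta_mx b 0) F u) a 0.

End Calculus.

(* A C^oo structure on M is given by an atlas; chart i is coord i, defined on
   dom i, with inverse param i. *)
Record manifold4 (R : realType) (M : topologicalType) := Manifold4 {
  chart : Type;
  dom : chart -> set M;
  coord : chart -> M -> 'cV[R]_4;
  param : chart -> 'cV[R]_4 -> M;
  chart_at : M -> chart;
  m_hausdorff : hausdorff_space M;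
  m_second_countable : @second_countable M;
  chart_atP : forall x, dom (chart_at x) x;
  dom_open : forall i, open (dom i);
  img_open : forall i, open (coord i @` dom i);
  coordK : forall i x, dom i x -> param i (coord i x) = x;
  coord_continuous : forall i x, dom i x -> {for x, continuous (coord i)};
  param_continuous : forall i u, (coord i @` dom i) u ->
    {for u, continuous (param i)};
  transition_smooth : forall i j,
    smooth_on (coord i @` (dom i `&` dom j)) (fun u => coord j (param i u))
}.

Section Tensors.
Variables (R : realType) (M : topologicalType) (X : manifold4 R M).
Implicit Types (i : chart X) (A G : M -> 'M[R]_4) (u v : 'cV[R]_4).

Definition img i : set 'cV[R]_4 := coord i @` dom i.

(* T_xM is 'cV_4, by means of the preferred chart chart_at x.  Hence a field of
   endomorphisms or of bilinear forms on TM is a function M -> 'M_4.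
   frame_change i x is the isomorphism from T_xM to 'cV_4 given by chart i. *)
Definition frame_change i (x : M) : 'M[R]_4 :=
  jac (fun u => coord i (param (chart_at X x) u)) (coord (chart_at X x) x).

Definition endo_rep i A u : 'M[R]_4 :=
  let P := frame_change i (param i u) in P *m A (param i u) *m invmx P.

Definition form_rep i G u : 'M[R]_4 :=
  let Q := invmx (frame_change i (param i u)) in Q^T *m G (param i u) *m Q.

Definition smooth_endo A := forall i, smooth_on (img i) (endo_rep i A).
Definition smooth_form G := forall i, smooth_on (img i) (form_rep i G).

Definition neutral_form (B : 'M[R]_4) : Prop :=
  B^T = B /\ exists2 P, P \in unitmx &
    P^T *m B *m P = diag_mx (\row_(a < 4) (if (a < 2)%N then 1 else -1)).

Definition lie_bracket (Y Z : 'cV[R]_4 -> 'cV[R]_4) u : 'cV[R]_4 :=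
  'D_(Y u) Z u - 'D_(Z u) Y u.

Definition nijenhuis (B : 'cV[R]_4 -> 'M[R]_4) (Y Z : 'cV[R]_4 -> 'cV[R]_4) u :
    'cV[R]_4 :=
  let BY := fun w => B w *m Y w in let BZ := fun w => B w *m Z w in
  B u *m (B u *m lie_bracket Y Z u) + lie_bracket BY BZ u
  - B u *m lie_bracket BY Z u - B u *m lie_bracket Y BZ u.

Definition integrable_endo A : Prop :=
  forall i (Y Z : 'cV[R]_4 -> 'cV[R]_4),
    smooth_on (img i) Y -> smooth_on (img i) Z ->
    forall u, img i u -> nijenhuis (endo_rep i A) Y Z u = 0.

(* Gamma^k_{ml} of the Levi-Civita connection of G in chart i. *)
Definition christoffel G i u (k m l : 'I_4) : R :=
  let g := form_rep i G in
  let dg (a b c : 'I_4) := ('D_(delta_mx a 0) g u) b c in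
  2^-1 * \sum_p invmx (g u) k p * (dg m p l + dg l p m - dg p m l).

Definition conn_form G i u v : 'M[R]_4 :=
  \matrix_(k, l) \sum_m christoffel G i u k m l * v m 0.

(* D_v A, for the Levi-Civita connection D of G *)
Definition cov_endo G i A u v : 'M[R]_4 :=
  'D_v (endo_rep i A) u
  + (conn_form G i u v *m endo_rep i A u - endo_rep i A u *m conn_form G i u v).

Definition parallel_endo G A : Prop :=
  forall i u v, img i u -> cov_endo G i A u v = 0.

End Tensors.

Section Model.
Variable R : realType.
Implicit Types y z : 'cV[R]_3.

Definition hyperboloid : set 'cV[R]_3 :=
  [set y | y 0 0 ^+ 2 - y 1 0 ^+ 2 - y 2 0 ^+ 2 = 1].

Definition inner3 y z : R := - (y 0 0 * z 0 0) + y 1 0 * z 1 0 + y 2 0 * z 2 0.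

Definition cross3 y z : 'cV[R]_3 :=
  \col_a [:: - (y 1 0 * z 2 0 - y 2 0 * z 1 0);
             y 2 0 * z 0 0 - y 0 0 * z 2 0;
             y 0 0 * z 1 0 - y 1 0 * z 0 0]`_a.

Definition hyperboloid_tangent y : set 'cV[R]_3 := [set z | inner3 y z = 0].

Definition holomorphic_H (phi : 'cV[R]_3 -> R[i]) : Prop :=
  holomorphic_on hyperboloid hyperboloid_tangent cross3 phi.

Definition antiholomorphic_H (phi : 'cV[R]_3 -> R[i]) : Prop :=
  antiholomorphic_on hyperboloid hyperboloid_tangent cross3 phi.

End Model.

Record almost_hyperhermitian (R : realType) (M : topologicalType)
    (X : manifold4 R M) := AlmostHyperhermitian {
  metric : M -> 'M[R]_4;
  J1 : M -> 'M[R]_4;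
  J2 : M -> 'M[R]_4;
  J3 : M -> 'M[R]_4;
  metric_smooth : smooth_form X metric;
  metric_neutral : forall x, neutral_form (metric x);
  J1_smooth : smooth_endo X J1;
  J2_smooth : smooth_endo X J2;
  J3_smooth : smooth_endo X J3;
  J1_sqr : forall x, J1 x *m J1 x = - 1%:M;
  J2_sqr : forall x, J2 x *m J2 x = 1%:M;
  J3_sqr : forall x, J3 x *m J3 x = 1%:M;
  J12 : forall x, J1 x *m J2 x = J3 x;
  J21 : forall x, - (J2 x *m J1 x) = J3 x;
  J1_compat : forall x, (J1 x)^T *m metric x *m J1 x = metric x;
  J2_compat : forall x, (J2 x)^T *m metric x *m J2 x = - metric x;
  J3_compat : forall x, (J3 x)^T *m metric x *m J3 x = - metric x
}.

Section Twistor.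
Variables (R : realType) (M : topologicalType) (X : manifold4 R M).
Variable h : almost_hyperhermitian X.
Implicit Types (i : chart X) (u v : 'cV[R]_4) (y w : 'cV[R]_3).

Definition hyperhermitian : Prop :=
  [/\ integrable_endo X (J1 h), integrable_endo X (J2 h) &
      integrable_endo X (J3 h)].

Definition hyperkahler : Prop :=
  hyperhermitian /\
  [/\ parallel_endo X (metric h) (J1 h), parallel_endo X (metric h) (J2 h) &
      parallel_endo X (metric h) (J3 h)].

Definition Jcomb y (x : M) : 'M[R]_4 :=
  y 0 0 *: J1 h x + y 1 0 *: J2 h x + y 2 0 *: J3 h x.

(* A point of End(TM) is a pair (x, s) with s : 'M_4 an endomorphism of T_xM. *)
Definition twistor_space : set (M * 'M[R]_4) :=
  [set s | exists2 y, hyperboloid y & s.2 = Jcomb y s.1].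

Definition twistor_proj (s : M * 'M[R]_4) : 'cV[R]_3 :=
  get [set y | hyperboloid y /\ s.2 = Jcomb y s.1].

(* The frame J1, J2, J3 and chart i trivialise E over dom i as
   img i * 'cV_3, the point (u, y) being the endomorphism Jcomb y (param i u).
   The twistor space becomes the submanifold twistor_chart i. *)
Definition twistor_chart i : set ('cV[R]_4 * 'cV[R]_3) :=
  [set q | img i q.1 /\ hyperboloid q.2].

Definition twistor_tangent (q : 'cV[R]_4 * 'cV[R]_3) :
  set ('cV[R]_4 * 'cV[R]_3) := [set t | inner3 q.2 t.2 = 0].

Definition twistor_fun i (f : M * 'M[R]_4 -> R[i])
    (q : 'cV[R]_4 * 'cV[R]_3) : R[i] :=
  f (param i q.1, Jcomb q.2 (param i q.1)).

(* The coefficients in the frame J1, J2, J3 of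
   y_1 D_v J1 + y_2 D_v J2 + y_3 D_v J3, which is a section of E. *)
Definition conn_coef i (q : 'cV[R]_4 * 'cV[R]_3) v : 'cV[R]_3 :=
  get [set w | cov_endo (metric h) i (Jcomb q.2) q.1 v
               = endo_rep i (Jcomb w) q.1].

(* A curve (u(t), y(t)) is parallel in E when y' + conn_coef (u, y) u' = 0. *)
Definition hlift i (q : 'cV[R]_4 * 'cV[R]_3) v : 'cV[R]_4 * 'cV[R]_3 :=
  (v, - conn_coef i q v).

Definition vpart i (q t : 'cV[R]_4 * 'cV[R]_3) : 'cV[R]_3 :=
  t.2 + conn_coef i q t.1.

(* The tangent vector t is hlift i q t.1 + (0, vpart i q t). *)
Definition twistor_J (k : nat) i (q t : 'cV[R]_4 * 'cV[R]_3) :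
    'cV[R]_4 * 'cV[R]_3 :=
  hlift i q (endo_rep i (Jcomb q.2) q.1 *m t.1)
  + (0, (-1) ^+ k.-1 *: cross3 q.2 (vpart i q t)).

(* Only the values of f on twistor_space matter. *)
Definition twistor_holomorphic (k : nat) (f : M * 'M[R]_4 -> R[i]) : Prop :=
  forall i, holomorphic_on (twistor_chart i) twistor_tangent
              (twistor_J k i) (twistor_fun i f).

End Twistor.

(* Main.v *)
(* For fixed y in H, the section x |-> Jcomb y x of Z is holomorphic from (M, J_y)
   to (Z, J_k).  For k = 1 this means D_{J_y v} J_y = cross(J_y, D_v J_y).  Since
   D is torsion-free, integrability of A = J1, J2, J3 makes
   (D_{AY} A - A D_Y A) Z symmetric in Y and Z; it is also skew in Z, hence zero,
   and the case of J_y follows by linear algebra.  For k = 2 the section is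
   horizontal.  So f restricted to the section satisfies the Cauchy-Riemann
   equations of J_y.  Differentiating these once more shows that its real part u
   satisfies, for every constant vector w,
     D_{J_y w}^2 u + D_w^2 u + (first order terms) = 0,
   which is enough for Hopf's touching-ball argument: u is locally constant
   where it attains its maximum, hence constant on the compact connected M.
   Thus f = phi o p, and phi is (anti)holomorphic because J_k is plus or minus
   cross(y, -) on vertical vectors. *)
From HB Require Import structures.
Require Import Defs.
From mathcomp Require Import all_boot all_order all_algebra.
From mathcomp Require Import all_classical all_reals.
From mathcomp Require Import topology normedtype derive.
From mathcomp Require Import complex.
From mathcomp Require Import landau ring lra.

Set Implicit Arguments.
Unset Strict Implicit.
Unset Printing Implicit Defensive.

Import Order.TTheory GRing.Theory Num.Theory.
Import numFieldNormedType.Exports.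
Local Open Scope classical_set_scope.
Local Open Scope ring_scope.

(** * Smooth maps between normed spaces *)

Section Smooth.
Variable R : realType.

Section Generic.
Variables (V V' W : normedModType R).

(** The Laplacian of a neutral metric is ultrahyperbolic and obeys no maximum principle, so the
    estimate has to come from J_y alone. For a fixed w the second-order operator is degenerate: only
    the directions w and J_y w occur in it. But Hopf's argument needs positivity in a single
    direction, the normal of the touching sphere at the point of contact, and w, being arbitrary,
    can be chosen to be that normal. Keeping an arbitrary chart, with a variable matrix [B] for J_y,
    avoids complex coordinates and with them the Newlander-Nirenberg theorem. The price is the
    first-order terms, which the barrier absorbs. It is a polynomial [beta * s ^+ 2 - s] in s = |z -
    c|^2 - r: zero on the sphere, negative just outside it, with [beta] left free to dominate all
    remaining terms. The two statements differ in two places only: the reason why sections with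
    constant y are holomorphic, and the sign of J_k on vertical vectors. Both are parameters of one
    common proof. *)

Lemma derive_comp_affine (f : V' -> W) (g : V -> V') (x v : V) (v' : V') :
    (forall k : R, g (k *: v + x) = k *: v' + g x) ->
  'D_v (fun z => f (g z)) x = 'D_v' f (g x) /\
  (derivable f (g x) v' -> derivable (fun z => f (g z)) x v).
Proof.
move=> gE; rewrite /derive /derivable.
have -> : (fun k : R => k^-1 *: (((fun z => f (g z)) \o shift x) (k *: v)
    - f (g x))) = fun k => k^-1 *: ((f \o shift (g x)) (k *: v') - f (g x)).
  by rewrite funeqE => k /=; rewrite gE.
by split.
Qed.

(** Derivability along [v] alone gives no differential on [V]. On the line through [x] it does,
    since in one variable derivability is differentiability, and linearity applies there. *)
Lemma deriveZv (f : V -> W) (k : R) x v :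
  derivable f x v -> 'D_(k *: v) f x = k *: 'D_v f x.
Proof.
move=> df; have [->|k0] := eqVneq k 0; first by rewrite !scale0r derive0.
have dfk : derivable (fun h : R => f (h *: v + x)) 0 1
  by exact: (derivable1P f x v).1 df.
have -> : 'D_(k *: v) f x = 'D_k (fun h : R => f (h *: v + x)) 0.
  rewrite /derive; apply: (f_equal (fun g : R -> W => lim (g @ 0^'))).
  rewrite funeqE => h /=.
  by rewrite addr0 scale0r add0r scalerA.
have -> : 'D_v f x = 'D_1 (fun h : R => f (h *: v + x)) 0.
  rewrite /derive; apply: (f_equal (fun g : R -> W => lim (g @ 0^'))).
  rewrite funeqE => h /=.
  by rewrite addr0 scale0r add0r [h%:A]mulr1.
have dd : differentiable (fun h : R => f (h *: v + x)) 0.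
  by apply/derivable1_diffP.
rewrite !deriveE // -[X in 'd _ _ X = _]mulr1.
by rewrite -[k * 1]/(k *: 1) linearZ.
Qed.

Lemma deriveNv (f : V -> W) x v :
  derivable f x v -> 'D_(- v) f x = - 'D_v f x.
Proof. by move=> df; rewrite -scaleN1r deriveZv // scaleN1r. Qed.

End Generic.

Section MVT.
Variable V : normedModType R.

Lemma is_derive_line (f : V -> R) (x v : V) (t : R) :
  derivable f (x + t *: v) v ->
  is_derive t 1 (fun s => f (x + s *: v)) ('D_v f (x + t *: v)).
Proof.
move=> df.
have [<- dg] : 'D_1 (fun s : R => f (x + s *: v)) t = 'D_v f (x + t *: v) /\
    (derivable f (x + t *: v) v -> derivable (fun s : R => f (x + s *: v)) t 1).
  apply: (@derive_comp_affine R^o V R f (fun s : R => x + s *: v)) => k.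
  by rewrite [k%:A]mulr1 scalerDl addrCA.
exact: DeriveDef (dg df) erefl.
Qed.

Lemma MVT_line (f : V -> R) (x v : V) (h : R) : 0 < h ->
    (forall t : R, 0 <= t <= h -> derivable f (x + t *: v) v) ->
  exists2 t : R, 0 < t < h & f (x + h *: v) - f x = h * 'D_v f (x + t *: v).
Proof.
move=> h0 df.
have dl (t : R) : 0 <= t <= h ->
    is_derive t 1 (fun s : R => f (x + s *: v)) ('D_v f (x + t *: v)).
  by move=> /df; exact: is_derive_line.
have cl : {within `[(0 : R), h], continuous (fun s : R => f (x + s *: v))}.
  apply: derivable_within_continuous => t; rewrite in_itv /= => /dl [].
  by [].
have [t] := @MVT R (fun s : R => f (x + s *: v))
  (fun t : R => 'D_v f (x + t *: v)) 0 h h0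
  (fun t t01 => dl t (subset_itv_oo_cc t01)) cl.
by rewrite in_itv /= scale0r addr0 subr0 mulrC => t01 E; exists t.
Qed.

End MVT.

Section SmoothOn.
Variables (V W : normedModType R).
Implicit Types (U : set V) (f g : V -> W).

Lemma iter_derive_rcons f s v :
  iter_derive ('D_v f) s = iter_derive f (rcons s v).
Proof. by rewrite /iter_derive foldr_rcons. Qed.

Lemma smooth_on_derive U f v : smooth_on U f -> smooth_on U ('D_v f).
Proof. by move=> sf s x Ux; rewrite iter_derive_rcons; exact: sf. Qed.

Lemma smooth_on_derivable U f x v : smooth_on U f -> U x -> derivable f x v.
Proof. by move=> sf Ux; have [_] := sf [::] x Ux. Qed.

Lemma smooth_on_continuous U f x : smooth_on U f -> U x -> {for x, continuous f}.
Proof. by move=> sf Ux; have [] := sf [::] x Ux. Qed.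

Lemma smooth_on_sub U U' f : U' `<=` U -> smooth_on U f -> smooth_on U' f.
Proof. by move=> UU sf s x /UU; exact: sf. Qed.

Lemma eq_on_iter_derive U f g s : open U -> (forall x, U x -> f x = g x) ->
  forall x, U x -> iter_derive f s x = iter_derive g s x.
Proof.
move=> oU fg; elim: s => // v s IH x Ux /=.
apply: near_eq_derive; have : nbhs x U by exact: open_nbhs_nbhs.
by apply: filterS => z Uz; exact: IH.
Qed.

Lemma eq_smooth_on U f g : open U -> (forall x, U x -> f x = g x) ->
  smooth_on U f -> smooth_on U g.
Proof.
move=> oU fg sf s x Ux.
have nU : nbhs x U by exact: open_nbhs_nbhs.
have E := eq_on_iter_derive s oU fg.
have [cf df] := sf s x Ux; split.
  rewrite /prop_for /continuous_at -E //.
  apply: cvg_trans cf; apply: near_eq_cvg.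
  by apply: filterS nU => z Uz; rewrite E.
move=> v; apply: near_eq_derivable (df v).
by apply: filterS nU => z Uz; rewrite E.
Qed.

Lemma smooth_on_local U f :
    (forall x, U x -> exists2 A, open A /\ A x & smooth_on A f) ->
  smooth_on U f.
Proof. by move=> H s x Ux; have [A [_ Ax] sf] := H x Ux; exact: sf. Qed.

Lemma iter_derive_cst (c : W) s x :
  iter_derive (cst c : V -> W) s x = if s is [::] then c else 0.
Proof.
elim: s x => //= v s IH x.
case: s IH => [|w s] IH /=; first exact: derive_cst.
suff -> : 'D_w (iter_derive (cst c : V -> W) s) = cst 0 by rewrite derive_cst.
by rewrite funeqE => z; exact: (IH z).
Qed.

Lemma smooth_on_cst U (c : W) : smooth_on U (cst c : V -> W).
Proof.
move=> s x _.
have -> : iter_derive (cst c : V -> W) s = cst (if s is [::] then c else 0).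
  by rewrite funeqE => z; rewrite iter_derive_cst.
by split; [exact: cst_continuous | move=> v; exact: derivable_cst].
Qed.

Lemma iter_deriveD U f g s x : open U -> smooth_on U f -> smooth_on U g -> U x ->
  iter_derive (f + g) s x = iter_derive f s x + iter_derive g s x.
Proof.
move=> oU sf sg; elim: s x => // v s IH x Ux.
rewrite [LHS](_ : _ = 'D_v (iter_derive f s + iter_derive g s) x).
  by rewrite deriveD //; [case: (sf s x Ux)|case: (sg s x Ux)].
apply: near_eq_derive; have : nbhs x U by exact: open_nbhs_nbhs.
by apply: filterS => z Uz; exact: IH.
Qed.

Lemma smooth_onD U f g : open U -> smooth_on U f -> smooth_on U g ->
  smooth_on U (f + g).
Proof.
move=> oU sf sg s x Ux.
have E z : U z -> (iter_derive f s + iter_derive g s) z = iter_derive (f + g) s z.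
  by move=> Uz; rewrite (iter_deriveD s oU).
have nU : nbhs x U by exact: open_nbhs_nbhs.
have [cf df] := sf s x Ux; have [cg dg] := sg s x Ux; split.
  rewrite /prop_for /continuous_at -E //.
  apply: cvg_trans (continuousD cf cg); apply: near_eq_cvg.
  by apply: filterS nU => z /E.
move=> v; apply: near_eq_derivable (derivableD (df v) (dg v)).
by apply: filterS nU => z /E.
Qed.

Lemma iter_deriveZ U f k s x : open U -> smooth_on U f -> U x ->
  iter_derive (k *: f) s x = k *: iter_derive f s x.
Proof.
move=> oU sf; elim: s x => // v s IH x Ux.
rewrite [LHS](_ : _ = 'D_v (k *: iter_derive f s) x).
  by rewrite deriveZ //; case: (sf s x Ux).
apply: near_eq_derive; have : nbhs x U by exact: open_nbhs_nbhs.
by apply: filterS => z Uz; exact: IH.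
Qed.

Lemma smooth_onZ U f (k : R) : open U -> smooth_on U f -> smooth_on U (k *: f).
Proof.
move=> oU sf s x Ux.
have E z : U z -> (k *: iter_derive f s) z = iter_derive (k *: f) s z.
  by move=> Uz; rewrite (iter_deriveZ k s oU).
have nU : nbhs x U by exact: open_nbhs_nbhs.
have [cf df] := sf s x Ux; split.
  rewrite /prop_for /continuous_at -E //.
  have ck : (k \*: iter_derive f s) @ x --> (k *: iter_derive f s) x.
    exact: cvgZl_tmp cf.
  apply: cvg_trans ck; apply: near_eq_cvg.
  by apply: filterS nU => z /E.
move=> v; have dk : derivable (k *: iter_derive f s) x v by exact: derivableZ.
apply: near_eq_derivable dk.
by apply: filterS nU => z /E.
Qed.

End SmoothOn.

(** The linear part [l] of [g] carries directions along, so each iterated derivative of the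
    composite is an iterated derivative of [f] along the images of the directions. *)
Lemma smooth_on_comp_affine (V V' W : normedModType R) (U : set V')
    (f : V' -> W) (g : V -> V') (l : V -> V') :
    (forall x v (k : R), g (k *: v + x) = k *: l v + g x) -> continuous g ->
  smooth_on U f -> smooth_on (g @^-1` U) (fun x => f (g x)).
Proof.
move=> gE cg sf s x Ux.
have E z : iter_derive (fun x => f (g x)) s z = iter_derive f (map l s) (g z).
  elim: s z => // v s IH z /=; rewrite -[LHS]/('D_v (iter_derive _ s) z).
  have -> : iter_derive (fun x => f (g x)) s
    = (fun z => iter_derive f (map l s) (g z)) by rewrite funeqE.
  by case: (@derive_comp_affine V V' W (iter_derive f (map l s)) g z v (l v)).
have -> : iter_derive (fun x => f (g x)) s
    = (fun z => iter_derive f (map l s) (g z)) by rewrite funeqE.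
have [cf df] := sf (map l s) (g x) Ux; split.
  by apply: (@continuous_comp _ _ _ g (iter_derive f (map l s))) => //; exact: cg.
move=> v.
have [_] := @derive_comp_affine V V' W (iter_derive f (map l s)) g x v (l v)
  (gE x v).
by apply; exact: df.
Qed.

End Smooth.

Lemma entry_le_norm (R : realType) m n (A : 'M[R]_(m, n)) i j :
  `|A i j| <= `|A|.
Proof.
rewrite [leRHS]/Num.Def.normr /= mx_normrE.
by apply: le_trans (le_bigmax _ _ (i, j)).
Qed.

(** * Differentiability from continuous directional derivatives; symmetry of second derivatives *)

Section Differential.
Variable R : realType.

Lemma continuous_near_lt (V : normedModType R) (f : V -> R) x (e : R) :
  {for x, continuous f} -> 0 < e -> \forall z \near x, `|f x - f z| < e.
Proof. by move=> /cvgrPdist_lt; exact. Qed.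

(** The passage from directional derivatives to a differential. The increment is made one direction
    at a time; the mean value theorem on the last leg gives a derivative at a nearby point, which
    continuity compares with the one at [x]. *)
Lemma C1_expansion (V : normedModType R) (U : set V) (f : V -> R) (x : V)
    (n : nat) (v : 'I_n -> V) (e : R) :
    open U -> U x -> smooth_on U f -> 0 < e ->
  exists2 d : R, 0 < d & forall c : 'I_n -> R, (forall k, `|c k| < d) ->
    `|f (x + \sum_k c k *: v k) - f x - \sum_k c k * 'D_(v k) f x|
    <= e * \sum_k `|c k|.
Proof.
move=> oU Ux sf e0; elim: n v => [|n IH] v.
  by exists 1 => // c _; rewrite !big_ord0 addr0 !subrr normr0 mulr0.
have [d d0 dP] := IH (fun k => v (widen_ord (leqnSn n) k)).
have cD : {for x, continuous ('D_(v ord_max) f)}.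
  exact: smooth_on_continuous (smooth_on_derive _ sf) Ux.
have : \forall z \near x, U z /\ `|'D_(v ord_max) f x - 'D_(v ord_max) f z| < e.
  apply: filterI; first exact: open_nbhs_nbhs (conj oU Ux).
  by move/cvgrPdist_lt : cD; exact.
move=> /nbhs_ballP[r /= r0 rP].
have S0 : 0 < \sum_k `|v k| + 1 by rewrite ltr_wpDl ?sumr_ge0.
(* This radius keeps the whole last leg in the ball where the last derivative varies by less than
   [e]; the added 1 keeps the denominator positive. *)
exists (Num.min d (r / (\sum_k `|v k| + 1))) => [|c cd].
  by rewrite lt_min d0 divr_gt0.
set y := \sum_(k < n) c (widen_ord (leqnSn n) k) *: v (widen_ord (leqnSn n) k).
have inball t : 0 <= t <= 1 ->
    ball x r (x + y + t *: (c ord_max *: v ord_max)).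
  move=> /andP[t0 t1]; rewrite -ball_normE /= -addrA opprD addNKr normrN.
  rewrite (le_lt_trans (ler_normD _ _))//.
  apply: (@le_lt_trans _ _ (\sum_k `|c k| * `|v k|)).
    rewrite big_ord_recr /= lerD //.
      rewrite (le_trans (ler_norm_sum _ _ _))// ler_sum // => k _.
      by rewrite normrZ.
    by rewrite normrZ normrZ ler_piMl ?mulr_ge0 // ger0_norm.
  apply: (@le_lt_trans _ _ ((r / (\sum_k `|v k| + 1)) * \sum_k `|v k|)).
    rewrite mulr_sumr ler_sum // => k _; rewrite ler_wpM2r //.
    by have := cd k; rewrite lt_min => /andP[_ /ltW].
  rewrite mulrAC -mulrA mulrC; rewrite -[ltRHS]mul1r ltr_pM2r//.
  by rewrite ltr_pdivrMr // mul1r ltrDl.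
have [t /andP[t0 t1] tE] : exists2 t : R, 0 < t < 1 &
    f (x + y + c ord_max *: v ord_max) - f (x + y) =
    'D_(c ord_max *: v ord_max) f (x + y + t *: (c ord_max *: v ord_max)).
  have [|t t01] := @MVT_line _ _ f (x + y) (c ord_max *: v ord_max) 1 ltr01.
    move=> t t01.
    by apply: smooth_on_derivable sf _; case: (rP _ (inball t t01)).
  by rewrite scale1r mul1r; exists t.
have [Uz Dz] := rP _ (inball t (introT andP (conj (ltW t0) (ltW t1)))).
rewrite deriveZv in tE; last exact: smooth_on_derivable sf Uz.
rewrite !big_ord_recr /= -/y addrA.
have dP' := dP (fun k => c (widen_ord (leqnSn n) k)).
have : (forall k, `|c (widen_ord (leqnSn n) k)| < d).
  by move=> k; have := cd (widen_ord (leqnSn n) k); rewrite lt_min => /andP[].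
move=> /dP'; rewrite -/y mulrDr => le1.
rewrite -(subrK (f (x + y)) (f (x + y + _))) tE.
set a := 'D__ _ _; set b := f _; set s := \sum_k _; set g := f x.
rewrite [X in `|X|](_ : _ = (b - g - s) +
  c ord_max * (a - 'D_(v ord_max) f x)); last first.
  by rewrite /GRing.scale /=; ring.
rewrite (le_trans (ler_normD _ _))// lerD // normrM mulrC ler_wpM2r //.
by rewrite distrC ltW.
Qed.

Lemma differentiable_of_bound (V W : normedModType R) (f : V -> W)
    (df : {linear V -> W}) x : continuous df ->
    (forall e : R, 0 < e ->
      \forall h \near (0 : V), `|f (x + h) - f x - df h| <= e * `|h|) ->
  differentiable f x /\ 'd f x = df :> (V -> W).
Proof.
move=> cdf H.
have dE : f \o shift x = cst (f x) + df +o_ 0 id.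
  apply/eqaddoP => e e0; apply: filterS (H e e0) => h le1.
  rewrite -[X in `|X|]/(f (h + x) - (f x + df h)) opprD addrA.
  by rewrite [h + x]addrC.
have dU := diff_unique cdf dE; split=> //.
by apply/diff_locallyP; rewrite dU.
Qed.

Lemma C1_differentiable n (U : set 'cV[R]_n) (f : 'cV[R]_n -> R) x :
  open U -> U x -> smooth_on U f ->
  differentiable f x /\
  forall v, 'd f x v = \sum_k v k 0 * 'D_(delta_mx k 0) f x.
Proof.
move=> oU Ux sf.
pose df (v : 'cV[R]_n) : R := \sum_k v k 0 * 'D_(delta_mx k 0) f x.
have df_lin : linear df.
  move=> k v w; rewrite /df scaler_sumr -big_split /=.
  by apply: eq_bigr => i _; rewrite !mxE mulrDl -mulrA.
pose dfM := GRing.isLinear.Build _ _ _ _ _ df_lin.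
pose dfL : {linear _ -> _} := HB.pack df dfM.
have cdf : continuous dfL.
  apply: continuous_big; first exact: add_continuous.
  move=> k _ z; apply: (@continuousM _ _ (fun v : 'cV[R]_n => v k 0)
    (cst ('D_(delta_mx k 0) f x))); last exact: cst_continuous.
  exact: coord_continuous.
have [e e0|dfx dU] := @differentiable_of_bound _ _ f dfL x cdf.
  (* The sum over the [n] coordinates is at most [n] times the sup norm. *)
  have e1 : 0 < e / (n%:R + 1) by rewrite divr_gt0 // ltr_wpDl.
  have [d d0 dP] := C1_expansion (fun k => delta_mx k 0) oU Ux sf e1.
  near=> h.
  have hE : h = \sum_k h k 0 *: delta_mx k 0.
    rewrite {1}(matrix_sum_delta h); apply: eq_bigr => k _.
    by rewrite big_ord1.
  have hle k : `|h k 0| <= `|h| by exact: entry_le_norm.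
  have := dP (fun k => h k 0); rewrite -hE.
  have hd : `|h| < d by near: h; apply: (@nbhs0_lt R 'cV[R]_n d d0).
  move=> /(_ (fun k => le_lt_trans (hle k) hd))/le_trans; apply.
  have n1 : 0 < n%:R + 1 :> R by rewrite ltr_wpDl.
  rewrite mulrAC ler_pdivrMr // -[leRHS]mulrA ler_pM2l //.
  apply: (@le_trans _ _ (\sum_(k < n) `|h|)).
    by apply: ler_sum => k _; exact: hle.
  by rewrite sumr_const card_ord mulrDr mulr1 mulr_natr lerDl.
by split=> // v; rewrite dU.
Unshelve. all: by end_near. Qed.

Lemma smooth_deriveE n (U : set 'cV[R]_n) (f : 'cV[R]_n -> R) x v :
  open U -> U x -> smooth_on U f ->
  'D_v f x = \sum_k v k 0 * 'D_(delta_mx k 0) f x.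
Proof.
by move=> oU Ux sf; have [dfx dE] := C1_differentiable oU Ux sf; rewrite deriveE.
Qed.

Lemma derive_chain (V : normedModType R) n (U : set 'cV[R]_n)
    (f : 'cV[R]_n -> R) (g : V -> 'cV[R]_n) x v :
  open U -> U (g x) -> smooth_on U f -> derivable g x v ->
  'D_v (fun z => f (g z)) x = 'D_('D_v g x) f (g x).
Proof.
move=> oU Ux sf dg; have [dfx _] := C1_differentiable oU Ux sf.
pose l := fun h : R => g (h *: v + x).
have dl1 : derivable l 0 1 by exact: (derivable1P g x v).1 dg.
have l0 : l 0 = g x by rewrite /l scale0r add0r.
have dl : differentiable l 0 by apply/derivable1_diffP.
have E (W : normedModType R) (k : V -> W) :
    'D_v k x = 'D_1 (fun h : R => k (h *: v + x)) 0.
  rewrite /derive; apply: (f_equal (fun g : R -> W => lim (g @ 0^'))).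
  by rewrite funeqE => h /=; rewrite addr0 scale0r add0r [h%:A]mulr1.
rewrite (E R) (E _ g) -/l.
rewrite -[fun h : R => _]/(f \o l) deriveE; last first.
  by apply: differentiable_comp => //; rewrite l0.
by rewrite diff_comp ?l0 // /= -deriveE // -deriveE // l0.
Qed.

Lemma smooth_deriveD n (U : set 'cV[R]_n) (f : 'cV[R]_n -> R) x v w :
  open U -> U x -> smooth_on U f ->
  'D_(v + w) f x = 'D_v f x + 'D_w f x.
Proof.
move=> oU Ux sf; rewrite !(smooth_deriveE _ oU Ux sf) -big_split /=.
by apply: eq_bigr => k _; rewrite mxE mulrDl.
Qed.

(* Both iterated derivatives are the limit of the second difference
   (f(x+hv+kw) - f(x+hv) - f(x+kw) + f(x)) / hk. *)
Lemma derive_sym (V : normedModType R) (U : set V) (f : V -> R) x v w :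
  open U -> U x -> smooth_on U f ->
  'D_v ('D_w f) x = 'D_w ('D_v f) x.
Proof.
move=> oU Ux sf.
have dd := smooth_on_derive; have sD := smooth_on_derivable.
have cvw : {for x, continuous ('D_v ('D_w f))}.
  exact: smooth_on_continuous (dd _ _ _ _ _ v (dd _ _ _ _ _ w sf)) Ux.
have cwv : {for x, continuous ('D_w ('D_v f))}.
  exact: smooth_on_continuous (dd _ _ _ _ _ w (dd _ _ _ _ _ v sf)) Ux.
apply/eqP; rewrite -subr_eq0 -normr_le0; apply/ler_addgt0Pl => e e0.
rewrite addr0.
have e2 : 0 < e / 2 by rewrite divr_gt0.
have : \forall z \near x, [/\ U z,
   `|'D_v ('D_w f) x - 'D_v ('D_w f) z| < e / 2 &
   `|'D_w ('D_v f) x - 'D_w ('D_v f) z| < e / 2].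
  have nU : nbhs x U by exact: open_nbhs_nbhs.
  have n1 := continuous_near_lt cvw e2; have n2 := continuous_near_lt cwv e2.
  exact: filterS3 (fun z Uz z1 z2 => And3 Uz z1 z2) nU n1 n2.
move=> /nbhs_ballP[r /= r0 rP].
have S0 : 0 < `|v| + `|w| + 1 by rewrite ltr_wpDl ?addr_ge0.
pose h := r / (`|v| + `|w| + 1).
have h0 : 0 < h by rewrite divr_gt0.
have inball s t : 0 <= s <= h -> 0 <= t <= h -> ball x r (x + s *: v + t *: w).
  move=> /andP[s0 sh] /andP[t0 th].
  rewrite -ball_normE /= -addrA opprD addNKr normrN.
  rewrite (le_lt_trans (ler_normD _ _))// !normrZ !ger0_norm //.
  apply: (@le_lt_trans _ _ (h * (`|v| + `|w|))).
    by rewrite mulrDr lerD // ler_wpM2r.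
  by rewrite /h mulrAC ltr_pdivrMr // ltr_pM2l // ltrDl.
(* The mean value theorem is used twice: along [a] for the increment [k] in direction [b], then
   along [b] for ['D_a f]. *)
have secdiff a b : (forall s t, 0 <= s <= h -> 0 <= t <= h ->
      ball x r (x + s *: a + t *: b)) ->
    exists2 z, ball x r z & (f (x + h *: a + h *: b) - f (x + h *: a)) -
     (f (x + h *: b) - f x) = h * (h * 'D_b ('D_a f) z).
  move=> ib.
  pose k z := f (z + h *: b) - f z.
  have hh : 0 <= h <= h by rewrite lexx ltW.
  have h00 : 0 <= (0 : R) <= h by rewrite lexx ltW.
  have dk (s : R) : 0 <= s <= h -> derivable k (x + s *: a) a /\
     'D_a k (x + s *: a) = 'D_a f (x + s *: a + h *: b) - 'D_a f (x + s *: a).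
    move=> sh.
    have d2 : derivable f (x + s *: a) a.
      have := ib s 0 sh h00; rewrite scale0r addr0 => /rP[Uz _ _].
      exact: sD sf Uz.
    have [E1 E2] := @derive_comp_affine R V V R f (fun z => z + h *: b)
      (x + s *: a) a a (fun k => esym (addrA _ _ _)).
    have d1 : derivable (fun z => f (z + h *: b)) (x + s *: a) a.
      by apply: E2; have [Uz _ _] := rP _ (ib s h sh hh); exact: sD sf Uz.
    split; first exact: derivableB d1 d2.
    by rewrite -E1; exact: deriveB d1 d2.
  have [s s0h sE] := MVT_line h0 (fun s sh => (dk s sh).1).
  have sh : 0 <= s <= h by case/andP: s0h => s0 s1; rewrite !ltW.
  have [t t0h tE] : exists2 t : R, 0 < t < h & 'D_a f (x + s *: a + h *: b)
      - 'D_a f (x + s *: a) = h * 'D_b ('D_a f) (x + s *: a + t *: b).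
    have Dd (t : R) : 0 <= t <= h ->
        derivable ('D_a f) (x + s *: a + t *: b) b.
      move=> th; have [Uz _ _] := rP _ (ib s t sh th).
      exact: sD (dd _ _ _ _ _ _ sf) Uz.
    exact: MVT_line h0 Dd.
  exists (x + s *: a + t *: b).
    by apply: (ib s t sh); case/andP: t0h => t0 t1; rewrite !ltW.
  by rewrite -tE -(dk s sh).2 -sE.
have [z /rP[_ _ zE] E1] := secdiff v w inball.
have [|z' /rP[_ zE' _] E2] := secdiff w v.
  by move=> s t sh th; rewrite addrAC; exact: inball.
have alg (a b c d p q : R) : (b - a) - (c - d) = h * (h * p) ->
    (b - c) - (a - d) = h * (h * q) -> p = q.
  move=> Ep Eq; do 2 apply: (mulfI (lt0r_neq0 h0)).
  by rewrite -Ep -Eq; ring.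
rewrite [x + h *: w + _]addrAC in E2.
have tri (p q k : R) : `|p - k| < e / 2 -> `|q - k| < e / 2 -> `|p - q| <= e.
  move=> pr qr; rewrite -(subrKA k) (le_trans (ler_normD _ _)) //.
  by rewrite [e]splitr lerD // ltW // distrC.
by apply: tri zE' _; rewrite -(alg _ _ _ _ _ _ E1 E2).
Qed.

End Differential.

(** * Calculus of matrix-valued maps *)

Section MatrixValued.
Variables (R : realType) (V : normedModType R).

Lemma derive_mxE m n (A : V -> 'M[R]_(m, n)) x v i j : derivable A x v ->
  'D_v (fun z => A z i j) x = ('D_v A x) i j.
Proof. by move=> dA; rewrite derive_mx // mxE. Qed.

Lemma iter_derive_mxE m n (U : set V) (A : V -> 'M[R]_(m, n)) s i j x :
  open U -> smooth_on U A -> U x ->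
  iter_derive (fun z => A z i j) s x = iter_derive A s x i j.
Proof.
move=> oU sA; elim: s x => // v s IH x Ux.
rewrite -[LHS]/('D_v (iter_derive (fun z => A z i j) s) x).
rewrite -[iter_derive A (v :: s) x]/('D_v (iter_derive A s) x).
rewrite -derive_mxE; last by have [_] := sA s x Ux.
apply: near_eq_derive; have : nbhs x U by exact: open_nbhs_nbhs.
by apply: filterS => z Uz; exact: IH.
Qed.

Lemma smooth_on_mx m n (U : set V) (A : V -> 'M[R]_(m, n)) i j :
  open U -> smooth_on U A -> smooth_on U (fun z => A z i j).
Proof.
move=> oU sA s x Ux; have nU : nbhs x U by exact: open_nbhs_nbhs.
have E z : U z -> iter_derive A s z i j = iter_derive (fun z => A z i j) s z.
  by move=> Uz; rewrite (iter_derive_mxE s i j oU sA Uz).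
have [cA dA] := sA s x Ux; split.
  rewrite /prop_for /continuous_at -E //.
  have cc : (fun z => iter_derive A s z i j) @ x --> iter_derive A s x i j.
    exact: continuous_comp cA (@coord_continuous _ _ _ i j _).
  by apply: cvg_trans cc; apply: near_eq_cvg; apply: filterS nU => z /E.
move=> v; have dAij : derivable (fun z => iter_derive A s z i j) x v.
  by move: i j {E}; apply/derivable_mxP; exact: dA.
by apply: near_eq_derivable dAij; apply: filterS nU => z /E.
Qed.

Lemma derivable_mulmx m n p (A : V -> 'M[R]_(m, n)) (B : V -> 'M[R]_(n, p)) x v :
    derivable A x v -> derivable B x v ->
  derivable (fun z => A z *m B z) x v /\
  'D_v (fun z => A z *m B z) x = 'D_v A x *m B x + A x *m 'D_v B x.
Proof.
move=> dA dB.
have E i j : is_derive x v (fun z => (A z *m B z) i j)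
    (('D_v A x *m B x + A x *m 'D_v B x) i j).
  have -> : (fun z => (A z *m B z) i j) =
      \sum_k ((fun z => A z i k) * (fun z => B z k j)).
    by rewrite funeqE => z; rewrite mxE fct_sumE.
  have -> : ('D_v A x *m B x + A x *m 'D_v B x) i j =
      \sum_k (A x i k *: ('D_v B x) k j + B x k j *: ('D_v A x) i k).
    rewrite !mxE -big_split /=; apply: eq_bigr => k _.
    by rewrite addrC /GRing.scale /= [B x k j * _]mulrC.
  apply: is_derive_sum => k; apply: is_deriveM; apply: DeriveDef.
  - by move: i k {j}; apply/derivable_mxP.
  - by rewrite derive_mxE.
  - by move: k j; apply/derivable_mxP.
  - by rewrite derive_mxE.
have dAB : derivable (fun z => A z *m B z) x v.
  by apply/derivable_mxP => i j; case: (E i j).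
split=> //; apply/matrixP => i j; rewrite -derive_mxE //.
by case: (E i j).
Qed.

Lemma derivable_mulmxl m n p (A : V -> 'M[R]_(m, n)) (a : 'M[R]_(n, p)) x v :
    derivable A x v ->
  derivable (fun z => A z *m a) x v /\
  'D_v (fun z => A z *m a) x = 'D_v A x *m a.
Proof.
move=> dA; have [dAa E] := derivable_mulmx dA (derivable_cst a x v).
by split=> //; rewrite [LHS]E derive_cst mulmx0 addr0.
Qed.

Lemma derivable_trmx m n (A : V -> 'M[R]_(m, n)) x v : derivable A x v ->
  derivable (fun z => (A z)^T) x v /\ 'D_v (fun z => (A z)^T) x = ('D_v A x)^T.
Proof.
move=> dA.
have dAT : derivable (fun z => (A z)^T) x v.
  apply/derivable_mxP => i j.
  have -> : (fun z => (A z)^T i j) = (fun z => A z j i).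
    by rewrite funeqE => z; rewrite mxE.
  by move: j i; apply/derivable_mxP.
split=> //; apply/matrixP => i j; rewrite mxE -!derive_mxE //.
by congr ('D_v _ x); rewrite funeqE => z; rewrite mxE.
Qed.

End MatrixValued.

Lemma smooth_mx_deriveE (R : realType) m n p (U : set 'cV[R]_p)
    (A : 'cV[R]_p -> 'M[R]_(m, n)) x v :
  open U -> U x -> smooth_on U A ->
  'D_v A x = \sum_k v k 0 *: 'D_(delta_mx k 0) A x.
Proof.
move=> oU Ux sA; apply/matrixP => i j.
have dA w : derivable A x w by exact: smooth_on_derivable sA Ux.
rewrite -derive_mxE // (smooth_deriveE v oU Ux (smooth_on_mx i j oU sA)).
by rewrite summxE; apply: eq_bigr => k _; rewrite mxE derive_mxE.
Qed.

(** * The strong maximum principle *)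

Section MaximumPrinciple.
Variable R : realType.

(** Leibniz rule for the sum of the coordinates of [C z] times the partial derivatives of [u]; the
    last term is due to the direction moving with [z]. *)
Lemma derive_along n (U : set 'cV[R]_n) (u : 'cV[R]_n -> R)
    (C : 'cV[R]_n -> 'cV[R]_n) x b :
    open U -> U x -> smooth_on U u -> derivable C x b ->
  'D_b (fun z => 'D_(C z) u z) x = 'D_b ('D_(C x) u) x + 'D_('D_b C x) u x.
Proof.
move=> oU Ux su dC; have nU : nbhs x U by exact: open_nbhs_nbhs.
pose p k z := 'D_(delta_mx k 0) u z.
have dp k : derivable (p k) x b.
  exact: smooth_on_derivable (smooth_on_derive _ su) Ux.
have dCk k : derivable (fun z => C z k 0) x b.
  by move: (k) (0 : 'I_1); apply/derivable_mxP.
have near_sum (E : 'cV[R]_n -> 'cV[R]_n) :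
    (forall k, derivable (fun z => E z k 0) x b) ->
    'D_b (fun z => 'D_(E z) u z) x =
    \sum_k (E x k 0 * 'D_b (p k) x + p k x * 'D_b (fun z => E z k 0) x).
  move=> dE; rewrite (@near_eq_derive _ _ _ _
    (\sum_k ((fun z => E z k 0) * p k))); last first.
    apply: filterS nU => z Uz.
    by rewrite (smooth_deriveE (E z) oU Uz su) fct_sumE.
  rewrite derive_sum => [|k]; last exact: derivableM.
  by apply: eq_bigr => k _; rewrite deriveM.
rewrite near_sum // (near_sum (cst (C x))); last first.
  by move=> k; exact: derivable_cst.
rewrite (smooth_deriveE ('D_b C x) oU Ux su) -big_split /=.
apply: eq_bigr => k _.
rewrite (_ : 'D_b (fun z => cst (C x) z k 0) x = 0); last exact: derive_cst.
by rewrite mulr0 addr0 derive_mxE // mulrC [_ * p k x]mulrC mulrC.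
Qed.

(* Differentiating the Cauchy-Riemann equations du(Bv) = -dv(v) once more,
   along Bw and along w, and eliminating the second derivatives of v. *)
Lemma cauchy_riemann_second_order n (U : set 'cV[R]_n) (u v : 'cV[R]_n -> R)
    (B : 'cV[R]_n -> 'M[R]_n) x w :
    open U -> U x -> smooth_on U u -> smooth_on U v -> smooth_on U B ->
    B x *m B x = - 1%:M ->
    (forall z a, U z -> 'D_(B z *m a) u z = - 'D_a v z) ->
  let W := B x *m w in
  'D_W ('D_W u) x + 'D_w ('D_w u) x
  + 'D_('D_W B x *m w - 'D_w B x *m W) u x = 0.
Proof.
have alg (a1 a2 a3 a4 a5 a6 : R) :
    - a3 = a1 + a5 -> - a4 = - a2 + a6 -> a3 = a4 -> a1 + a2 + (a5 - a6) = 0.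
  by lra.
move=> oU Ux su sv sB B2 CR W; have nU : nbhs x U by exact: open_nbhs_nbhs.
have D1 a b : 'D_b (fun z => 'D_(B z *m a) u z) x = - 'D_b ('D_a v) x.
  rewrite (@near_eq_derive _ _ _ _ (- 'D_a v)); last first.
    by apply: filterS nU => z Uz; rewrite CR.
  by rewrite deriveN //; exact: smooth_on_derivable (smooth_on_derive _ sv) Ux.
have D2 a b : 'D_b (fun z => 'D_(B z *m a) u z) x =
    'D_b ('D_(B x *m a) u) x + 'D_('D_b B x *m a) u x.
  have dB : derivable B x b by exact: smooth_on_derivable sB Ux.
  have [dBa E] := derivable_mulmxl a dB.
  by rewrite (derive_along oU Ux su dBa) E.
(* [W] is frozen at [x]. The two instances contain the two mixed second derivatives of [v], which
   agree, and [B x *m W = - w] turns the leading term of the second one into a second derivative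
   along [w]. *)
have E1 := D2 w W; rewrite D1 -/W in E1.
have E2 := D2 W w; rewrite D1 in E2.
have BW : B x *m W = - w by rewrite /W mulmxA B2 mulNmx mul1mx.
have E3 : 'D_w ('D_(B x *m W) u) x = - 'D_w ('D_w u) x.
  rewrite BW (@near_eq_derive _ _ _ _ (- 'D_w u)); last first.
    apply: filterS nU => z Uz.
    by rewrite (deriveNv (smooth_on_derivable su Uz)).
  by rewrite deriveN //; exact: smooth_on_derivable (smooth_on_derive _ su) Ux.
rewrite E3 in E2.
have E4 := derive_sym W w oU Ux sv.
rewrite (smooth_deriveD _ _ oU Ux su) (deriveNv (smooth_on_derivable su Ux)).
exact: alg E1 E2 E4.
Qed.

Lemma derive_at_max (V : normedModType R) (G : V -> R) x w (d : R) :
    0 < d ->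
    (forall t : R, `|t| < d -> derivable G (x + t *: w) w) ->
    (forall t : R, `|t| < d -> G (x + t *: w) <= G x) ->
  'D_w G x = 0.
Proof.
move=> d0 dG mG.
have dl (t : R) : t \in `](- d), d[ ->
    derivable (fun s : R => G (x + s *: w)) t 1.
  by rewrite in_itv /= -ltr_norml => /dG/is_derive_line[].
have zd : (0 : R) \in `](- d), d[ by rewrite in_itv /= oppr_lt0 d0.
have [||_] := derive1_at_max _ dl zd.
- by rewrite (@le_trans _ _ 0) // ?oppr_le0 ltW.
- move=> t; rewrite in_itv /= -ltr_norml scale0r addr0; exact: mG.
have dG0 : derivable G (x + 0 *: w) w by apply: dG; rewrite normr0.
by case: (is_derive_line dG0) => _ ->; rewrite scale0r addr0.
Qed.

(** Otherwise ['D_w G], which vanishes at [x], would be positive just after [x] on the line, and by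
    the mean value theorem [G] would exceed its maximum. *)
Lemma derive2_at_max (V : normedModType R) (G : V -> R) x w (d : R) :
    0 < d ->
    (forall t : R, `|t| < d -> derivable G (x + t *: w) w) ->
    (forall t : R, `|t| < d -> G (x + t *: w) <= G x) ->
    derivable ('D_w G) x w ->
  'D_w ('D_w G) x <= 0.
Proof.
move=> d0 dG mG ddG; rewrite leNgt; apply/negP => L0.
have G0 := derive_at_max d0 dG mG.
have : \forall h \near (0 : R)^', 0 < h^-1 * 'D_w G (h *: w + x).
  have : h^-1 *: (('D_w G \o shift x) (h *: w) - 'D_w G x) @[h --> (0 : R)^']
      --> 'D_w ('D_w G) x by exact: ddG.
  move/cvgr_gt => /(_ _ L0); apply: filterS => h.
  by rewrite /= G0 subr0.
move=> [e /= e0 eP].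
pose h := Num.min (d / 2) (e / 2).
have d2 : 0 < d / 2 by rewrite divr_gt0.
have e2 : 0 < e / 2 by rewrite divr_gt0.
have h0 : 0 < h by rewrite lt_min d2.
have hd : h < d.
  rewrite (@le_lt_trans _ _ (d / 2)) // ?ge_min ?lexx // ltr_pdivrMr //.
  by rewrite mulr_natr mulr2n ltrDl.
have he : h < e.
  rewrite (@le_lt_trans _ _ (e / 2)) // ?ge_min ?lexx ?orbT // ltr_pdivrMr //.
  by rewrite mulr_natr mulr2n ltrDl.
have dh (t : R) : 0 <= t <= h -> derivable G (x + t *: w) w.
  by move=> /andP[t0 th]; apply: dG; rewrite ger0_norm // (le_lt_trans th).
have [t /andP[t0 th] E] := MVT_line h0 dh.
have : 0 < t^-1 * 'D_w G (t *: w + x).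
  apply: eP; last by rewrite gt_eqF.
  by rewrite /ball /= sub0r normrN gtr0_norm // (lt_trans th).
rewrite pmulr_rgt0 ?invr_gt0 // addrC => Dt.
have := mG h; rewrite gtr0_norm // => /(_ hd).
by rewrite -subr_le0 E leNgt mulr_gt0.
Qed.

End MaximumPrinciple.

(** * Continuity of matrix expressions *)

Section EntrywiseContinuity.
Variables (R : realType) (V : normedModType R).

Lemma continuous_at_sum (I : finType) (F : I -> V -> R) x :
    (forall i, {for x, continuous (F i)}) ->
  {for x, continuous (fun z => \sum_i F i z)}.
Proof.
move=> cF; rewrite /prop_for /continuous_at.
exact: (@cvg_big R I +%R 0 xpredT (@add_continuous R) V (nbhs x)
  (index_enum I) F (fun i => F i x) _ (fun i _ => cF i)).
Qed.

Definition entries_continuous m n (x : V) (A : V -> 'M[R]_(m, n)) :=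
  forall i j, {for x, continuous (fun z => A z i j)}.

Lemma entries_continuous_cst m n x (A : 'M[R]_(m, n)) :
  entries_continuous x (fun=> A).
Proof. by move=> i j; exact: cst_continuous. Qed.

Lemma entries_continuousW m n x (A : V -> 'M[R]_(m, n)) :
  {for x, continuous A} -> entries_continuous x A.
Proof.
by move=> cA i j; exact: continuous_comp cA (@coord_continuous _ _ _ i j _).
Qed.

Lemma entries_continuousM m n p x (A : V -> 'M[R]_(m, n))
    (B : V -> 'M[R]_(n, p)) :
  entries_continuous x A -> entries_continuous x B ->
  entries_continuous x (fun z => A z *m B z).
Proof.
move=> cA cB i j.
have -> : (fun z => (A z *m B z) i j) = fun z => \sum_k A z i k * B z k j.
  by rewrite funeqE => z; rewrite mxE.
by apply: continuous_at_sum => k; exact: continuousM.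
Qed.

Lemma entries_continuousB m n x (A B : V -> 'M[R]_(m, n)) :
  entries_continuous x A -> entries_continuous x B ->
  entries_continuous x (fun z => A z - B z).
Proof.
move=> cA cB i j.
have -> : (fun z => (A z - B z) i j) = (fun z => A z i j) - (fun z => B z i j).
  by rewrite funeqE => z; rewrite !mxE.
exact: continuousB.
Qed.

Lemma entries_continuous_sumZ m n (I : finType) x (a : I -> V -> R)
    (A : I -> V -> 'M[R]_(m, n)) :
  (forall k, {for x, continuous (a k)}) ->
  (forall k, entries_continuous x (A k)) ->
  entries_continuous x (fun z => \sum_k a k z *: A k z).
Proof.
move=> ca cA i j.
have -> : (fun z => (\sum_k a k z *: A k z) i j) =
    fun z => \sum_k a k z * A k z i j.
  by rewrite funeqE => z; rewrite summxE; apply: eq_bigr => k _; rewrite mxE.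
by apply: continuous_at_sum => k; apply: continuousM => //; exact: cA.
Qed.

End EntrywiseContinuity.

(** * Euclidean distance and the barrier function *)

Section Barrier.
Variables (R : realType) (n : nat).
Implicit Types x y z w : 'cV[R]_n.

(** The norm on ['cV[R]_n] is the sup norm, whose balls are cubes; touching balls have to be
    round. *)
Definition dot x y : R := \sum_k x k 0 * y k 0.

Lemma dotC x y : dot x y = dot y x.
Proof. by apply: eq_bigr => k _; rewrite mulrC. Qed.

Lemma dotDl x y z : dot (x + y) z = dot x z + dot y z.
Proof. by rewrite -big_split; apply: eq_bigr => k _; rewrite mxE mulrDl. Qed.

Lemma dotZl a x y : dot (a *: x) y = a * dot x y.
Proof. by rewrite mulr_sumr; apply: eq_bigr => k _; rewrite mxE mulrA. Qed.

Lemma dotNl x y : dot (- x) y = - dot x y.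
Proof. by rewrite -scaleN1r dotZl mulN1r. Qed.

Lemma dotDr x y z : dot z (x + y) = dot z x + dot z y.
Proof. by rewrite dotC dotDl !(dotC z). Qed.

Lemma dotZr a x y : dot y (a *: x) = a * dot y x.
Proof. by rewrite dotC dotZl dotC. Qed.

Lemma dotNr x y : dot y (- x) = - dot y x.
Proof. by rewrite dotC dotNl dotC. Qed.

Lemma dot_ge0 x : 0 <= dot x x.
Proof. by apply: sumr_ge0 => k _; rewrite -expr2 sqr_ge0. Qed.

Lemma dot_eq0 x : dot x x = 0 -> x = 0.
Proof.
move=> /eqP; rewrite psumr_eq0; last by move=> k _; rewrite -expr2 sqr_ge0.
move=> /allP x0; apply/colP => k; rewrite mxE; apply/eqP.
by have := x0 k (mem_index_enum k); rewrite -expr2 sqrf_eq0.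
Qed.

Lemma dot_gt0 x : (0 < dot x x) = (x != 0).
Proof.
rewrite lt_def dot_ge0 andbT; congr (~~ _); apply/eqP/eqP => [/dot_eq0 //|->].
by rewrite /dot big1 // => k _; rewrite mxE mul0r.
Qed.

Lemma entry_le_dot x k : x k 0 ^+ 2 <= dot x x.
Proof.
rewrite /dot (bigD1 k) //= -expr2 lerDl.
by apply: sumr_ge0 => i _; rewrite -expr2 sqr_ge0.
Qed.

Lemma entry_le_of_dot x k (r : R) : 0 <= r -> dot x x <= r ^+ 2 -> `|x k 0| <= r.
Proof.
move=> r0 xr; rewrite -(@ler_pXn2r _ 2) ?nnegrE // real_normK ?num_real //.
exact: le_trans (entry_le_dot x k) xr.
Qed.

Lemma dot_sqrD x y : dot (x + y) (x + y) = dot x x + 2 * dot x y + dot y y.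
Proof. by rewrite dotDl !dotDr (dotC y x); ring. Qed.

Lemma dot_sqrD_le x y : dot (x + y) (x + y) <= 2 * dot x x + 2 * dot y y.
Proof.
have := dot_ge0 (x - y); rewrite !dot_sqrD dotNr dotNl dotNr.
by lra.
Qed.

(* The ball of radius |q| about -q meets the sphere of radius |2q| about -2q at
   the origin only. *)
Lemma dot_tangent_ball p q : 0 < dot p p -> dot (p + q) (p + q) <= dot q q ->
  dot (p + 2 *: q) (p + 2 *: q) < dot (2 *: q) (2 *: q).
Proof. by rewrite !dot_sqrD !dotZl !dotZr; lra. Qed.

Lemma dot_delta y k : dot y (delta_mx k 0) = y k 0.
Proof.
rewrite /dot (bigD1 k) //= big1 => [|i ik].
  by rewrite addr0 !mxE !eqxx mulr1.
by rewrite [delta_mx _ _ _ _]mxE (negbTE ik) mulr0.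
Qed.

Lemma continuous_dot (V : normedModType R) (v : V) (C E : V -> 'cV[R]_n) :
  entries_continuous v C -> entries_continuous v E ->
  {for v, continuous (fun t => dot (C t) (E t))}.
Proof.
by move=> cC cE; apply: continuous_at_sum => k; apply: continuousM;
  [exact: cC|exact: cE].
Qed.

Lemma entries_continuous_shift c x : entries_continuous x (fun z => z - c).
Proof.
apply: entries_continuousB; last exact: entries_continuous_cst.
by apply: entries_continuousW; exact: cvg_id.
Qed.

Lemma continuous_dist2 c : continuous (fun z => dot (z - c) (z - c)).
Proof.
move=> z; exact: (continuous_dot (@entries_continuous_shift c z)
  (@entries_continuous_shift c z)).
Qed.

Lemma is_derive_dotl c a x w :
  is_derive x w (fun z => dot (z - c) a) (dot w a).
Proof.
have d k : is_derive x w (fun z => (z - c) k 0 * a k 0) (w k 0 * a k 0).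
  have -> : (fun z => (z - c) k 0 * a k 0) =
      a k 0 *: ((fun z => z k 0) - cst (c k 0)).
    by rewrite funeqE => z; rewrite !mxE mulrC.
  rewrite -[w k 0]subr0 mulrC; apply: is_deriveZ; apply: is_deriveB.
  have di : derivable (fun z : 'cV[R]_n => z) x w by exact: derivable_id.
  apply: DeriveDef.
    by move: (k) (0 : 'I_1); apply/derivable_mxP.
  by rewrite (derive_mxE k 0 di) derive_id.
have -> : (fun z => dot (z - c) a) = \sum_k (fun z => (z - c) k 0 * a k 0).
  by rewrite funeqE => z; rewrite fct_sumE.
exact: is_derive_sum.
Qed.

Lemma is_derive_dist2 c x w :
  is_derive x w (fun z => dot (z - c) (z - c)) (2 * dot (x - c) w).
Proof.
have -> : (fun z => dot (z - c) (z - c)) =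
    \sum_k ((fun z => dot (z - c) (delta_mx k 0)) *
            (fun z => dot (z - c) (delta_mx k 0))).
  rewrite funeqE => z; rewrite fct_sumE; apply: eq_bigr => k _.
  rewrite -[RHS]/(dot (z - c) (delta_mx k 0) * dot (z - c) (delta_mx k 0)).
  by rewrite dot_delta.
have -> : 2 * dot (x - c) w = \sum_k
    (dot (x - c) (delta_mx k 0) *: dot w (delta_mx k 0) +
     dot (x - c) (delta_mx k 0) *: dot w (delta_mx k 0)).
  rewrite {1}/dot mulr_sumr; apply: eq_bigr => k _.
  by rewrite !dot_delta /GRing.scale /= mulrDl mul1r.
apply: is_derive_sum => k; apply: is_deriveM; exact: is_derive_dotl.
Qed.

(* For beta large, the operator of [cauchy_riemann_second_order], with w the
   radius from c to a point of the sphere of square radius r, is positive on it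
   at that point. *)
Definition barrier (beta r : R) c z : R :=
  beta * (dot (z - c) (z - c) - r) ^+ 2 - (dot (z - c) (z - c) - r).

Lemma is_derive_barrier beta r c x w :
  is_derive x w (barrier beta r c)
    ((2 * beta * (dot (x - c) (x - c) - r) - 1) * (2 * dot (x - c) w)).
Proof.
have ds : is_derive x w ((fun z => dot (z - c) (z - c)) - cst r)
    (2 * dot (x - c) w - 0).
  by apply: is_deriveB; exact: is_derive_dist2.
have -> : barrier beta r c =
    beta *: (((fun z => dot (z - c) (z - c)) - cst r) *
             ((fun z => dot (z - c) (z - c)) - cst r)) -
    ((fun z => dot (z - c) (z - c)) - cst r).
  by rewrite funeqE => z; rewrite /barrier expr2.
apply: is_derive_eq (is_deriveB (is_deriveZ beta (is_deriveM ds ds)) ds) _.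
rewrite subr0 /GRing.scale /=.
rewrite -[(_ - cst r) x]/(dot (x - c) (x - c) - r).
by set a := dot _ _; set b := dot _ _; ring.
Qed.

Lemma is_derive2_barrier beta r c x w :
  is_derive x w ('D_w (barrier beta r c))
    (8 * beta * dot (x - c) w ^+ 2 +
     (2 * beta * (dot (x - c) (x - c) - r) - 1) * (2 * dot w w)).
Proof.
have ds : is_derive x w ((fun z => dot (z - c) (z - c)) - cst r)
    (2 * dot (x - c) w - 0).
  by apply: is_deriveB; exact: is_derive_dist2.
have -> : 'D_w (barrier beta r c) =
    (((2 * beta) *: ((fun z => dot (z - c) (z - c)) - cst r) - cst 1) *
     (2 *: (fun z => dot (z - c) w))).
  by rewrite funeqE => z; case: (is_derive_barrier beta r c z w).
have d1 := is_deriveB (is_deriveZ (2 * beta) ds) (is_derive_cst (1 : R) x w).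
have d2 := is_deriveZ 2 (is_derive_dotl c w x w).
apply: is_derive_eq (is_deriveM d1 d2) _; rewrite !subr0 /GRing.scale /=.
rewrite -[(_ - cst 1) x]/(2 * beta * (dot (x - c) (x - c) - r) - 1).
rewrite -[2 *: dot _ _]/(2 * dot (x - c) w).
by set a := dot _ _; set b := dot _ _; set d := dot w w; ring.
Qed.

Lemma continuous_barrier beta r c x : {for x, continuous (barrier beta r c)}.
Proof.
have cs : {for x, continuous ((fun z => dot (z - c) (z - c)) - cst r)}.
  apply: continuousB; last exact: cst_continuous.
  by apply: continuous_dot; exact: entries_continuous_shift.
have -> : barrier beta r c =
   (fun z => cst beta z * (((fun z => dot (z - c) (z - c)) - cst r) z *
     ((fun z => dot (z - c) (z - c)) - cst r) z)) -
   ((fun z => dot (z - c) (z - c)) - cst r).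
  by rewrite funeqE => z; rewrite /barrier expr2.
apply: continuousB => //; apply: continuousM; first exact: cst_continuous.
exact: continuousM.
Qed.

End Barrier.

Lemma norm_mx_le (R : realType) m n (A : 'M[R]_(m, n)) (r : R) :
  0 <= r -> (forall i j, `|A i j| <= r) -> `|A| <= r.
Proof.
move=> r0 Ar; rewrite [leLHS]/Num.Def.normr /= mx_normrE.
by apply: bigmax_le => // -[i j] _; exact: Ar.
Qed.

Lemma norm_trmx_le (R : realType) m n (A : 'M[R]_(m, n)) : `|A^T| <= `|A|.
Proof.
apply: norm_mx_le => [|i j]; first exact: normr_ge0.
by rewrite mxE; exact: entry_le_norm.
Qed.

Lemma continuous_trmx (R : realType) m n :
  continuous (fun A : 'M[R]_(m, n) => A^T).
Proof.
move=> A B [P nP sPB]; exists (fun i j => P j i) => [i j|C PC].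
  by have := nP j i; rewrite mxE.
by apply: sPB => i j; rewrite mxE; exact: PC.
Qed.

Lemma bounded_closed_compact_cV (R : realType) n (A : set 'cV[R]_n) :
  bounded_set A -> closed A -> compact A.
Proof.
move=> bA cA.
have nT (v : 'rV[R]_n) : `|v^T| = `|v|.
  by apply/eqP; rewrite eq_le norm_trmx_le -{1}[v]trmxK norm_trmx_le.
have -> : A = (fun v : 'rV[R]_n => v^T) @` ((fun v => v^T) @^-1` A).
  apply/seteqP; split=> [v Av|_ [v Av <-] //].
  by exists v^T; rewrite ?trmxK //= trmxK.
apply: continuous_compact.
  by apply: continuous_subspaceT; exact: continuous_trmx.
apply: bounded_closed_compact.
  move: bA => [M [Mr MP]]; exists M; split=> // x /MP xP v Av.
  by have /= := xP _ Av; rewrite nT.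
by apply: preimage_closed => // v _; exact: continuous_trmx.
Qed.

Lemma continuous_dist (R : realType) n (x z : 'cV[R]_n) :
  {for z, continuous (fun t : 'cV[R]_n => `|x - t|)}.
Proof.
apply: (@continuous_comp _ _ _ (fun t : 'cV[R]_n => x - t)
  (fun t : 'cV[R]_n => `|t|)); last exact: norm_continuous.
by apply: continuousB; [exact: cst_continuous|exact: cvg_id].
Qed.

Lemma closed_ball_compact_cV (R : realType) n (x : 'cV[R]_n) (r : R) :
  compact [set z | `|x - z| <= r].
Proof.
apply: bounded_closed_compact_cV.
  exists (`|x| + r); split; first exact: num_real.
  move=> M xM z /= xz; apply: le_trans (ltW xM).
  by rewrite -[z](subKr x) (le_trans (ler_normB _ _)) // lerD.
have -> : [set z | `|x - z| <= r] = (fun z => `|x - z|) @^-1` [set t | t <= r].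
  by [].
apply: preimage_closed; last exact: closed_le.
by move=> z _; exact: continuous_dist.
Qed.

(** * Hopf's argument for the real part of a solution of the Cauchy-Riemann equations *)

Section StrongMaximum.
Variables (R : realType) (n : nat).
Variables (U : set 'cV[R]_n) (u v : 'cV[R]_n -> R) (B : 'cV[R]_n -> 'M[R]_n).
Hypotheses (oU : open U) (su : smooth_on U u) (sv : smooth_on U v)
  (sB : smooth_on U B).
Hypothesis B2 : forall z, U z -> B z *m B z = - 1%:M.
Hypothesis CR : forall z a, U z -> 'D_(B z *m a) u z = - 'D_a v z.

(** The first-order vector field of the equation. The derivative of [B] along [B z *m w] is expanded
    in the standard basis because its direction moves with [z]; this makes continuity in [z]
    visible. *)
Let b (w z : 'cV[R]_n) : 'cV[R]_n :=
  (\sum_k (B z *m w) k 0 *: 'D_(delta_mx k 0) B z) *m w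
  - 'D_w B z *m (B z *m w).

Let second_order w z : U z ->
  'D_(B z *m w) ('D_(B z *m w) u) z + 'D_w ('D_w u) z + 'D_(b w z) u z = 0.
Proof.
move=> Uz; have := cauchy_riemann_second_order w oU Uz su sv sB (B2 Uz) CR.
by rewrite /= (smooth_mx_deriveE (B z *m w) oU Uz sB).
Qed.

Let b_continuous w x : U x -> entries_continuous x (b w).
Proof.
move=> Ux; have cB : entries_continuous x B.
  exact: entries_continuousW (smooth_on_continuous sB Ux).
have cDB a : entries_continuous x ('D_a B).
  exact: entries_continuousW (smooth_on_continuous (smooth_on_derive a sB) Ux).
have cBw : entries_continuous x (fun z => B z *m w).
  exact: (entries_continuousM cB (@entries_continuous_cst _ _ _ _ x w)).
have cS : entries_continuous x
    (fun z => \sum_k (B z *m w) k 0 *: 'D_(delta_mx k 0) B z).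
  by apply: entries_continuous_sumZ => k; [exact: cBw|exact: cDB].
exact: (entries_continuousB
  (entries_continuousM cS (@entries_continuous_cst _ _ _ _ x w))
  (entries_continuousM (cDB w) cBw)).
Qed.

(* Otherwise u + eps * barrier would, for small eps > 0, have a maximum in the
   interior of a small ball about x1, where [second_order] gives T <= 0. *)
Lemma no_single_contact c x1 (m : R) :
    U x1 -> (forall z, U z -> u z <= m) -> u x1 = m -> x1 != c ->
    (forall z, U z -> dot (z - c) (z - c) <= dot (x1 - c) (x1 - c) ->
       z != x1 -> u z < m) ->
  False.
Proof.
have alg (eps a1 a2 a3 p1 p2 p3 : R) : a1 + eps * p1 <= 0 ->
    a2 + eps * p2 <= 0 -> a3 + eps * p3 = 0 -> a2 + a1 + a3 = 0 ->
    eps * (p1 + p2 + p3) <= 0.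
  by lra.
have alg2 (k l q1 q2 q3 t : R) : 0 <= t ->
    k + l * (q1 + q2 + q3) <= k + l * q1 + (t + l * q2) + l * q3.
  by lra.
move=> Ux um ux1 x1c ltm.
pose w := x1 - c; pose r := dot w w.
have r0 : 0 < r by rewrite dot_gt0 subr_eq0.
(* Write L for the operator of [second_order]. Then [q] is L [s], and [T] is L [h] without the
   nonnegative term in the square of [dot (z - c) (B z *m w)]. At [x1], where [s] is 0 and z - c is
   [w], [T] equals 8 beta r^2 - q; this [beta] makes it |q| + 1 - q, which is positive. *)
pose q z := 2 * dot w w + 2 * dot (B z *m w) (B z *m w) +
  2 * dot (z - c) (b w z).
pose beta := (`|q x1| + 1) / (8 * r ^+ 2).
pose h := barrier beta r c.
pose s z := dot (z - c) (z - c) - r.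
pose T z := 8 * beta * dot (z - c) w ^+ 2 + (2 * beta * s z - 1) * q z.
have beta0 : 0 < beta by rewrite divr_gt0 ?mulr_gt0 ?exprn_gt0 // ltr_wpDl.
have s1 : s x1 = 0 by rewrite /s -/w subrr.
have T1 : 0 < T x1.
  have -> : T x1 = `|q x1| + 1 - q x1.
    rewrite /T s1 mulr0 sub0r mulN1r -/w -/r /beta; congr (_ - _).
    by field; rewrite lt0r_neq0.
  by have := ler_norm (q x1); lra.
have cs z1 : {for z1, continuous s}.
  apply: continuousB; last exact: cst_continuous.
  by apply: continuous_dot; exact: entries_continuous_shift.
have cq : {for x1, continuous q}.
  have cB : entries_continuous x1 (fun z => B z *m w).
    apply: entries_continuousM; last exact: entries_continuous_cst.
    exact: entries_continuousW (smooth_on_continuous sB Ux).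
  have c2 : {for x1, continuous (fun=> 2 : R)} by exact: cst_continuous.
  apply: continuousD; last first.
    apply: (continuousM c2); apply: continuous_dot.
      exact: entries_continuous_shift.
    exact: b_continuous.
  apply: continuousD; first exact: cst_continuous.
  by apply: (continuousM c2); exact: continuous_dot.
have cT : {for x1, continuous T}.
  have cw : {for x1, continuous (fun z : 'cV[R]_n => dot (z - c) w)}.
    apply: continuous_dot; last exact: entries_continuous_cst.
    exact: entries_continuous_shift.
  apply: continuousD.
    apply: continuousM; first exact: cst_continuous.
    exact: (continuousM cw cw).
  apply: continuousM => //; apply: continuousB; last exact: cst_continuous.
  by apply: continuousM => //; exact: cst_continuous.
have h1 : h x1 = 0 by rewrite /h /barrier -/(s x1) s1 expr0n mulr0 subrr.
have : \forall z \near x1, [/\ U z, 0 < T z, beta * s z < 1 & h z < 1].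
  have nU : nbhs x1 U by exact: open_nbhs_nbhs.
  have n1 : \forall z \near x1, 0 < T z by exact: cvgr_gt cT _ T1.
  have n2 : \forall z \near x1, s z < beta^-1.
    by apply: cvgr_lt (cs x1) _ _; rewrite s1 invr_gt0.
  have n3 : \forall z \near x1, h z < 1.
    by apply: cvgr_lt (@continuous_barrier _ _ beta r c x1) _ _; rewrite -/h h1.
  near=> z; split.
  - by near: z.
  - by near: z.
  - rewrite mulrC -ltr_pdivlMr // div1r; by near: z.
  - by near: z.
move=> /nbhs_ballP[e /= e0 eP].
pose d := e / 2.
have d0 : 0 < d by rewrite divr_gt0.
have dP z : `|x1 - z| <= d -> [/\ U z, 0 < T z, beta * s z < 1 & h z < 1].
  move=> zd; apply: eP; rewrite -ball_normE /= (le_lt_trans zd) //.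
  by rewrite ltr_pdivrMr // mulr_natr mulr2n ltrDl.
(* The part of the boundary lying in the closed round ball is compact and misses [x1], so [u] stays
   below [m] there by a fixed gap, taken as [eps]; any value serves if that part is empty. *)
have [eps eps0 epsP] : exists2 eps : R, 0 < eps &
    forall z, `|x1 - z| = d -> s z <= 0 -> u z <= m - eps.
  pose K := [set z | `|x1 - z| <= d] `&`
    ([set z | d <= `|x1 - z|] `&` [set z | s z <= 0]).
  have inK z : `|x1 - z| = d -> s z <= 0 -> K z.
    by move=> zd sz; split; rewrite /= ?zd // lexx.
  have [K0|nK] := pselect (K !=set0); last first.
    by exists 1 => // z zd sz; exfalso; apply: nK; exists z; exact: inK.
  have cK : compact K.
    apply: compact_closedI; first exact: closed_ball_compact_cV.
    apply: closedI.
      rewrite (_ : [set z | d <= _] =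
        (fun z => `|x1 - z|) @^-1` [set t | d <= t]) //.
      apply: preimage_closed; last exact: closed_ge.
      by move=> z _; exact: continuous_dist.
    rewrite (_ : [set z | s z <= _] = s @^-1` [set t | t <= 0]) //.
    by apply: preimage_closed; [move=> z _; exact: cs|exact: closed_le].
  have cu : {within K, continuous u}.
    apply: continuous_in_subspaceT => z /set_mem[/dP[Uz _ _ _] _].
    exact: smooth_on_continuous su Uz.
  have [k /set_mem kK kmax] := compact_EVT_max K0 cK cu.
  have [kd [dk sk]] := kK.
  have [Uk _ _ _] := dP _ kd.
  exists (m - u k).
    rewrite subr_gt0; apply: ltm => //; first by rewrite -subr_le0.
    by apply/eqP => kx; move: dk; rewrite /= kx subrr normr0 leNgt d0.
  by move=> z zd sz; rewrite opprB addrC subrK; apply: kmax; exact/mem_set/inK.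
pose G := u + eps *: h.
have cG z : U z -> {for z, continuous G}.
  move=> Uz; apply: continuousD; first exact: smooth_on_continuous su Uz.
  have ce : {for z, continuous (fun=> eps)} by exact: cst_continuous.
  exact: (continuousM ce (@continuous_barrier _ _ beta r c z)).
have [x2 x2N x2max] : exists2 x2, `|x1 - x2| <= d &
    forall z, `|x1 - z| <= d -> G z <= G x2.
  have cw : {within [set z | `|x1 - z| <= d], continuous G}.
    by apply: continuous_in_subspaceT => z /set_mem/dP[Uz _ _ _]; exact: cG.
  have N0 : [set z | `|x1 - z| <= d] !=set0.
    by exists x1; rewrite /= subrr normr0 ltW.
  have [k /set_mem kK kmax] := compact_EVT_max N0
    (@closed_ball_compact_cV _ _ x1 d) cw.
  by exists k => // z zd; apply: kmax; exact: mem_set.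
have [Ux2 T2 bs2 h2] := dP _ x2N.
have Gx2 : m <= G x2.
  have := x2max x1; rewrite subrr normr0 => /(_ (ltW d0)).
  by rewrite -[G x1]/(u x1 + eps * h x1) h1 mulr0 addr0 ux1.
have x2d : `|x1 - x2| < d.
  rewrite lt_neqAle x2N andbT; apply/eqP => E.
  move: Gx2; apply/negP; rewrite -ltNge -[G x2]/(u x2 + eps * h x2).
  (* The maximum of [G] is not on the boundary: inside the round ball the gap [eps] exceeds
     [eps * h] as [h < 1], and outside it [beta * s < 1] makes [h] negative. *)
  have [s2|s2] := lerP (s x2) 0.
    rewrite -ltrBrDr; apply: le_lt_trans (epsP _ E s2) _.
    by rewrite ltrD2l ltrN2 gtr_pMr.
  rewrite -[ltRHS]addr0 ler_ltD ?um // pmulr_rlt0 //.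
  have -> : h x2 = s x2 * (beta * s x2 - 1) by rewrite /h /barrier -/(s x2); ring.
  by rewrite pmulr_rlt0 // subr_lt0.
have dG z a : U z -> derivable G z a /\
    'D_a G z = 'D_a u z + eps * ((2 * beta * s z - 1) * (2 * dot (z - c) a)).
  move=> Uz; have du := smooth_on_derivable su Uz (v := a).
  have [dh Eh] := is_derive_barrier beta r c z a.
  have dh' : derivable (eps *: h) z a by exact: derivableZ.
  split; first exact: derivableD.
  by rewrite (deriveD du dh') (deriveZ eps dh) Eh.
have ddG z a : U z -> derivable ('D_a G) z a /\
    'D_a ('D_a G) z = 'D_a ('D_a u) z + eps * (8 * beta * dot (z - c) a ^+ 2 +
     (2 * beta * s z - 1) * (2 * dot a a)).
  move=> Uz; have du := smooth_on_derivable (smooth_on_derive a su) Uz (v := a).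
  have [dh Eh] := is_derive2_barrier beta r c z a.
  have dh' : derivable (eps *: 'D_a h) z a by exact: derivableZ.
  have E : \forall y \near z, ('D_a u + eps *: 'D_a h) y = 'D_a G y.
    have : nbhs z U by exact: open_nbhs_nbhs.
    apply: filterS => y Uy; rewrite (dG y a Uy).2.
    by have [_ <-] := is_derive_barrier beta r c y a.
  have dS := derivableD du dh'.
  split; first exact: near_eq_derivable E dS.
  by rewrite -(near_eq_derive _ E) (deriveD du dh') (deriveZ eps dh) Eh.
have line a : exists2 t0 : R, 0 < t0 &
    forall t : R, `|t| < t0 -> `|x1 - (x2 + t *: a)| <= d.
  have a1 : 0 < `|a| + 1 by rewrite ltr_wpDl.
  exists ((d - `|x1 - x2|) / (`|a| + 1)); first by rewrite divr_gt0 ?subr_gt0.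
  move=> t; rewrite ltr_pdivlMr // opprD addrA => td.
  rewrite (le_trans (ler_normB _ _)) // normrZ -lerBrDl.
  by apply: le_trans (ltW td); rewrite ler_wpM2l // lerDl.
have max1 a : 'D_a G x2 = 0.
  have [t0 t00 t0P] := line a.
  apply: (derive_at_max t00) => t /t0P tz; last exact: x2max.
  by have [Uz _ _ _] := dP _ tz; case: (dG _ a Uz).
have max2 a : 'D_a ('D_a G) x2 <= 0.
  have [t0 t00 t0P] := line a.
  apply: (derive2_at_max t00) => [t /t0P tz|t /t0P tz|].
  - by have [Uz _ _ _] := dP _ tz; case: (dG _ a Uz).
  - exact: x2max.
  - by case: (ddG _ a Ux2).
have := max2 w; rewrite (ddG _ w Ux2).2 => I1.
have := max2 (B x2 *m w); rewrite (ddG _ (B x2 *m w) Ux2).2 => I2.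
have := max1 (b w x2); rewrite (dG _ (b w x2) Ux2).2 => I3.
have I4 := second_order w Ux2.
(* When the three conditions at the maximum are added, [second_order] cancels the terms in [u] and
   leaves [eps] times L [h] at most 0. *)
have := alg _ _ _ _ _ _ _ I1 I2 I3 I4.
rewrite pmulr_rle0 // leNgt => /negP; apply.
apply: lt_le_trans T2 _; rewrite /T /q -/(s x2).
apply: alg2; rewrite mulr_ge0 ?sqr_ge0 // mulr_ge0 //.
exact: ltW.
Unshelve. all: by end_near. Qed.

(** If [u c < m] for some [c] close to [a], let [x1] be a point of the contact set u = m nearest to
    [c]. The sphere about [c] may meet that set in several points; the ball of half the radius
    inside it, tangent at [x1], meets it in [x1] only, which [no_single_contact] excludes. *)
Lemma maximum_locally_constant a (m : R) :
    U a -> (forall z, U z -> u z <= m) -> u a = m -> \forall z \near a, u z = m.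
Proof.
move=> Ua um ua.
have : nbhs a U by exact: open_nbhs_nbhs.
move=> /nbhs_ballP[e /= e0 eU].
(* [c] is within [rho] of [a] and the nearest contact point within [rho] of [c], so all stays within
   [2 * rho < e] of [a]. *)
pose rho := e / 3.
have rho0 : 0 < rho by rewrite divr_gt0.
have near_a z : dot (z - a) (z - a) <= 4 * rho ^+ 2 -> `|a - z| <= 2 * rho.
  move=> za; rewrite distrC; apply: norm_mx_le; first by rewrite mulr_ge0 // ltW.
  move=> i j; rewrite (ord1 j); apply: entry_le_of_dot.
    by rewrite mulr_ge0 // ltW.
  by have -> : (2 * rho) ^+ 2 = 4 * rho ^+ 2 by ring.
have inU z : `|a - z| <= 2 * rho -> U z.
  move=> az; apply: eU; rewrite -ball_normE /= (le_lt_trans az) //.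
  by rewrite /rho; lra.
have ca : \forall c \near a, dot (c - a) (c - a) < rho ^+ 2.
  have cd : {for a, continuous (fun c : 'cV[R]_n => dot (c - a) (c - a))}.
    exact: continuous_dist2.
  apply: cvgr_lt cd _ _.
  by rewrite subrr /dot big1 ?exprn_gt0 // => k _; rewrite mxE mul0r.
apply: filterS ca => c c_a.
have rho2 : 0 <= rho ^+ 2 by exact: sqr_ge0.
have Uc : U c by apply/inU/near_a; move: c_a rho2; lra.
apply/eqP; rewrite -[_ == _]negbK; apply/negP => ucm.
(* The sup-norm bound provides compactness; the Euclidean one is the form in which nearness to [c]
   is turned into nearness to [a]. *)
pose A := [set z | `|a - z| <= 2 * rho] `&`
  ([set z | dot (z - a) (z - a) <= 4 * rho ^+ 2] `&` [set z | u z = m]).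
have closedA : closed A.
  move=> p clA.
  have closure_sub (C : set 'cV[R]_n) : A `<=` C -> closed C -> C p.
    by move=> AC cC; apply: cC => D /clA[y [/AC Cy Dy]]; exists y.
  have pN : `|a - p| <= 2 * rho.
    apply: (closure_sub [set z | `|a - z| <= 2 * rho]); first by move=> z [].
    exact: compact_closed (@norm_hausdorff _ _) (@closed_ball_compact_cV _ _ _ _).
  have Up := inU _ pN.
  split=> //; split.
    apply: (closure_sub [set z | dot (z - a) (z - a) <= 4 * rho ^+ 2]).
      by move=> z [_ []].
    rewrite (_ : [set z | _ <= _] = (fun z => dot (z - a) (z - a)) @^-1`
      [set t | t <= 4 * rho ^+ 2]) //.
    apply: preimage_closed; last exact: closed_le.
    by move=> z _; exact: continuous_dist2.
  apply/eqP; rewrite eq_le um //= leNgt; apply/negP => upm.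
  have cu : {for p, continuous u} by exact: smooth_on_continuous su Up.
  have nm : \forall z \near p, u z < m by exact: cvgr_lt cu _ upm.
  by have [y [[_ [_ uy]] /=]] := clA _ nm; rewrite uy ltxx.
have cA : compact A.
  apply: subclosed_compact closedA (@closed_ball_compact_cV _ _ a (2 * rho)) _.
  by move=> z [].
have Aa : A a.
  have daa : dot (a - a) (a - a) = 0.
    by rewrite subrr /dot big1 // => k _; rewrite mxE mul0r.
  split; first by rewrite /= subrr normr0 mulr_ge0 // ltW.
  by split=> //=; rewrite daa mulr_ge0.
have cw : {within A, continuous (fun z : 'cV[R]_n => dot (z - c) (z - c))}.
  by apply: continuous_subspaceT; exact: continuous_dist2.
have [x1 /set_mem[x1N [x1a ux1]] x1min] :=
  compact_EVT_min (ex_intro _ a Aa) cA cw.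
have x1c : dot (x1 - c) (x1 - c) < rho ^+ 2.
  apply: le_lt_trans (x1min a (mem_set Aa)) _.
  by rewrite -[a - c]opprB dotNl dotNr opprK.
(* The midpoint of [c] and [x1] is the centre of the smaller tangent ball. *)
pose c' := c + 2^-1 *: (x1 - c).
have x1c' : x1 - c = 2 *: (x1 - c').
  rewrite /c' opprD addrA; set p := x1 - c.
  have -> : p - 2^-1 *: p = 2^-1 *: p.
    by rewrite -{1}[p]scale1r -scalerBl; congr (_ *: _); lra.
  by rewrite scalerA mulfV ?scale1r // pnatr_eq0.
have Ux1 := inU _ x1N.
apply: (@no_single_contact c' x1 m Ux1 um ux1).
  apply/eqP => E; move: x1c'; rewrite -E subrr scaler0 => /eqP.
  by rewrite subr_eq0 => /eqP x1E; move: ucm; rewrite -x1E ux1 eqxx.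
move=> z Uz zc' zx1; rewrite lt_neqAle um // andbT; apply/eqP => uz.
have zE : z - c = (z - x1) + 2 *: (x1 - c') by rewrite -x1c' addrA subrK.
have zE' : z - c' = (z - x1) + (x1 - c') by rewrite addrA subrK.
have p0 : 0 < dot (z - x1) (z - x1) by rewrite dot_gt0 subr_eq0.
have zc : dot (z - c) (z - c) < dot (x1 - c) (x1 - c).
  by rewrite zE x1c'; apply: dot_tangent_ball p0 _; rewrite -zE'.
have za : dot (z - a) (z - a) <= 4 * rho ^+ 2.
  have := dot_sqrD_le (z - c) (c - a); rewrite addrA subrK.
  by move: zc x1c c_a; set p := dot _ _; set q := dot _ _; lra.
have := x1min z (mem_set (conj (near_a _ za) (conj za uz))).
by rewrite leNgt zc.
Qed.

End StrongMaximum.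

(** * Split quaternions acting on a neutral space *)

Section SkewEndomorphisms.
Variables (R : realFieldType) (g : 'M[R]_4).
Implicit Types (x y z : 'cV[R]_4) (A B K : 'M[R]_4).

Definition form x y : R := (x^T *m g *m y) 0 0.

Definition skew A := A^T *m g = - (g *m A).

Lemma formDr x y z : form x (y + z) = form x y + form x z.
Proof. by rewrite /form mulmxDr mxE. Qed.

Lemma formZr k x y : form x (k *: y) = k * form x y.
Proof. by rewrite /form -scalemxAr mxE. Qed.

Lemma formNr x y : form x (- y) = - form x y.
Proof. by rewrite -scaleN1r formZr mulN1r. Qed.

Lemma form_skew A x y : skew A -> form (A *m x) y = - form x (A *m y).
Proof.
move=> sA; rewrite /form trmx_mul -[_ *m _ *m g]mulmxA sA mulmxN mulNmx mxE.
by rewrite !mulmxA.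
Qed.

Lemma skewB A B : skew A -> skew B -> skew (A - B).
Proof.
rewrite /skew => sA sB; rewrite linearB /= mulmxBl sA sB mulmxBr.
by rewrite opprB opprK addrC.
Qed.

Lemma skewD A B : skew A -> skew B -> skew (A + B).
Proof.
by rewrite /skew => sA sB; rewrite linearD /= mulmxDl sA sB mulmxDr opprD.
Qed.

Lemma skewZ k A : skew A -> skew (k *: A).
Proof.
by rewrite /skew => sA; rewrite linearZ /= -scalemxAl sA -scalemxAr scalerN.
Qed.

Lemma skewM A B : skew A -> skew B -> A *m B = - (B *m A) -> skew (A *m B).
Proof.
rewrite /skew => sA sB AB; rewrite trmx_mul -mulmxA sA mulmxN (mulmxA B^T).
rewrite sB mulNmx opprK.
by rewrite -mulmxA AB mulmxN opprK.
Qed.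

Hypothesis g_sym : g^T = g.

Lemma form_sym x y : form x y = form y x.
Proof.
rewrite /form; transitivity ((x^T *m g *m y)^T 0 0); first by rewrite [RHS]mxE.
by rewrite !trmx_mul trmxK g_sym mulmxA.
Qed.

Lemma form_skew_diag A x : skew A -> form x (A *m x) = 0.
Proof.
move=> sA; have := form_skew x x sA; rewrite form_sym => /eqP.
by rewrite -addr_eq0 -mulr2n mulrn_eq0 => /eqP.
Qed.

Hypothesis g_unit : g \in unitmx.

Lemma form_nondeg x : (forall y, form y x = 0) -> x = 0.
Proof.
move=> x0; have gx : g *m x = 0.
  apply/colP => k; rewrite [RHS]mxE -(x0 (delta_mx k 0)) /form trmx_delta.
  by rewrite -mulmxA -rowE [RHS]mxE.
by rewrite -[x]mul1mx -(mulVmx g_unit) -mulmxA gx mulmx0.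
Qed.

(** The argument that makes the Levi-Civita connection unique: [form z (N x *m y)] is symmetric in
    [x], [y] and skew in [y], [z]. Applying the two rules alternately, three times each, returns to
    the start with the opposite sign. *)
Lemma skew_symmetric_eq0 (N : 'cV[R]_4 -> 'M[R]_4) :
    (forall x, skew (N x)) -> (forall x y, N x *m y = N y *m x) ->
  forall x, N x = 0.
Proof.
move=> sN symN x.
suff N0 y : N x *m y = 0.
  apply/matrixP => i j; have /colP/(_ i) := N0 (delta_mx j 0).
  by rewrite -colE !mxE.
apply: form_nondeg => z.
have skewN a b c : form a (N b *m c) = - form c (N b *m a).
  by rewrite form_sym form_skew.
have := skewN z x y; rewrite (symN x z) (skewN y z x) (symN z y) opprK.
rewrite (skewN x y z) (symN y x) => /eqP.
by rewrite -addr_eq0 -mulr2n mulrn_eq0 => /eqP.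
Qed.

Variables (a b c : 'M[R]_4) (ea eb : R) (e : 'cV[R]_4).
Hypotheses (ea0 : ea != 0) (eb0 : eb != 0).
Hypotheses (aa : a *m a = ea%:M) (bb : b *m b = eb%:M).
Hypotheses (ab : a *m b = c) (ba : b *m a = - c).
Hypotheses (sa : skew a) (sb : skew b).
Hypothesis e_nonnull : form e e != 0.

Let ac : a *m c = ea *: b. Proof. by rewrite -ab mulmxA aa mul_scalar_mx. Qed.
Let ca : c *m a = - (ea *: b).
Proof. by rewrite -[c]opprK -ba mulNmx -mulmxA aa mul_mx_scalar. Qed.
Let bc : b *m c = - (eb *: a).
Proof. by rewrite -[c]opprK -ba mulmxN mulmxA bb mul_scalar_mx. Qed.
Let cb : c *m b = eb *: a. Proof. by rewrite -ab -mulmxA bb mul_mx_scalar. Qed.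
Let cc : c *m c = (- (ea * eb))%:M.
Proof.
by rewrite -{1}ab -mulmxA bc mulmxN -scalemxAr aa scale_scalar_mx raddfN mulrC.
Qed.
Let sc : skew c.
Proof. by rewrite -ab; apply: skewM => //; rewrite ab ba opprK. Qed.

(** Skewness of [a], [b], [c] makes the images of the non-null vector [e] orthogonal and non-null,
    hence a basis. The squares [ea], [eb] are kept general so that J1, J2 can enter in either
    order. *)
Let frame (j : 'I_4) : 'cV[R]_4 :=
  [:: e; a *m e; b *m e; c *m e]`_j.
Let F : 'M[R]_4 := \matrix_(i, j) frame j i 0.

Let colF j : col j F = frame j.
Proof. by apply/colP => i; rewrite !mxE. Qed.

Let F_gram : F^T *m g *m F = diag_mx (\row_j
  (form e e * [:: 1; - ea; - eb; ea * eb]`_j)).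
Proof.
have E i j : (F^T *m g *m F) i j = form (frame i) (frame j).
  rewrite -!colF /form tr_col -row_mul !mxE; apply: eq_bigr => k _.
  by rewrite [row _ _ _ _]mxE [col _ _ _ _]mxE.
have aae : form (a *m e) (a *m e) = - ea * form e e.
  by rewrite form_skew // mulmxA aa mul_scalar_mx formZr mulNr.
have bbe : form (b *m e) (b *m e) = - eb * form e e.
  by rewrite form_skew // mulmxA bb mul_scalar_mx formZr mulNr.
have cce : form (c *m e) (c *m e) = ea * eb * form e e.
  by rewrite form_skew // mulmxA cc mul_scalar_mx formZr mulNr opprK.
have ea_ : form e (a *m e) = 0 by exact: form_skew_diag.
have eb_ : form e (b *m e) = 0 by exact: form_skew_diag.
have ec_ : form e (c *m e) = 0 by exact: form_skew_diag.
have abe : form (a *m e) (b *m e) = 0.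
  by rewrite form_skew // mulmxA ab ec_ oppr0.
have ace : form (a *m e) (c *m e) = 0.
  by rewrite form_skew // mulmxA ac -scalemxAl formZr eb_ mulr0 oppr0.
have bce : form (b *m e) (c *m e) = 0.
  rewrite form_skew // mulmxA bc mulNmx -scalemxAl formNr formZr ea_.
  by rewrite mulr0 !oppr0.
apply/matrixP => i j; rewrite E !mxE.
case: i => [[|[|[|[|//]]]] ilt]; case: j => [[|[|[|[|//]]]] jlt];
  rewrite /frame /= ?mulr1n ?mulr0n ?mulr1 ?aae ?bbe ?cce ?ea_ ?eb_ ?ec_ ?abe ?ace
    ?bce 1?mulrC // form_sym ?ea_ ?eb_ ?ec_ ?abe ?ace ?bce //.
Qed.

Let F_unit : F \in unitmx.
Proof.
have : F^T *m g *m F \in unitmx.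
  rewrite F_gram unitmxE det_diag unitfE; apply/prodf_neq0 => j _; rewrite mxE.
  rewrite mulf_neq0 //.
  by case: j => [[|[|[|[|//]]]] jlt] /=; rewrite ?oner_neq0 ?oppr_eq0 ?mulf_neq0.
by rewrite unitmx_mul => /andP[].
Qed.

Let frame_eq0 (K : 'M[R]_4) : K *m e = 0 -> K *m (a *m e) = 0 ->
  K *m (b *m e) = 0 -> K *m (c *m e) = 0 -> K = 0.
Proof.
move=> Ke Ka Kb Kc; rewrite -[K]mulmx1 -(mulmxV F_unit) mulmxA.
suff -> : K *m F = 0 by rewrite mul0mx.
apply/matrixP => i j; transitivity (col j (K *m F) i 0).
  by rewrite [RHS]mxE.
rewrite colE -mulmxA -colE colF [RHS]mxE /frame.
by case: j => [[|[|[|[|//]]]] jlt] /=; rewrite ?Ke ?Ka ?Kb ?Kc mxE.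
Qed.

Let frame_orthogonal z : form z e = 0 -> form z (a *m e) = 0 ->
  form z (b *m e) = 0 -> form z (c *m e) = 0 -> z = 0.
Proof.
move=> ze za zb zc.
suff zF : z^T *m g *m F = 0.
  have zg : z^T *m g = 0.
    by rewrite -[LHS]mulmx1 -(mulmxV F_unit) mulmxA zF mul0mx.
  by rewrite -[z]trmxK -[z^T]mulmx1 -(mulmxV g_unit) mulmxA zg mul0mx trmx0.
apply/matrixP => i j; rewrite (ord1 i).
transitivity (col j (z^T *m g *m F) 0 0); first by rewrite [RHS]mxE.
rewrite colE -mulmxA -colE colF -[LHS]/(form z (frame j)) [RHS]mxE /frame.
by case: j => [[|[|[|[|//]]]] jlt] /=.
Qed.

(* The anti-self-dual part of a skew endomorphism anticommuting with [a]:
   the projection of [K] to span(b, c) kills the orthogonal frame e, ae, be, ce,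
   since [K e] is orthogonal to [e] and [a e]. *)
Lemma skew_anticommuting_span K : skew K -> K *m a = - (a *m K) ->
  exists s t : R, K = s *: b + t *: c.
Proof.
move=> sK Ka.
pose nu := form e e.
(* The coordinates of [K *m e] along [b *m e] and [c *m e], whose squares are the denominators. *)
pose s := form (b *m e) (K *m e) / (- eb * nu).
pose t := form (c *m e) (K *m e) / (ea * eb * nu).
exists s, t; apply/eqP; rewrite -subr_eq0; apply/eqP.
pose L := K - (s *: b + t *: c); rewrite -/L.
have sL : skew L by apply: skewB => //; apply: skewD; exact: skewZ.
have La : L *m a = - (a *m L).
  rewrite /L mulmxBl mulmxBr Ka mulmxDl mulmxDr -!scalemxAl -!scalemxAr.
  by rewrite ba ca ab ac !scalerN -!opprD.
have saL : skew (a *m L) by apply: skewM => //; rewrite La opprK.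
have abe : form (a *m e) (b *m e) = 0.
  by rewrite form_skew // mulmxA ab form_skew_diag ?oppr0.
have bce : form (b *m e) (c *m e) = 0.
  rewrite form_skew // mulmxA bc mulNmx -scalemxAl formNr formZr.
  by rewrite form_skew_diag ?mulr0 ?oppr0.
have bbe : form (b *m e) (b *m e) = - eb * nu.
  by rewrite form_skew // mulmxA bb mul_scalar_mx formZr mulNr.
have cce : form (c *m e) (c *m e) = ea * eb * nu.
  by rewrite form_skew // mulmxA cc mul_scalar_mx formZr mulNr opprK.
have Le : L *m e = 0.
  apply: frame_orthogonal.
  - by rewrite form_sym form_skew_diag.
  - rewrite form_sym form_skew // mulmxA form_skew_diag ?oppr0 //.
  - rewrite form_sym /L mulmxBl mulmxDl -!scalemxAl formDr formNr formDr !formZr.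
    rewrite bbe bce mulr0 addr0 /s divfK ?subrr //.
    by rewrite mulf_neq0 ?oppr_eq0.
  - rewrite form_sym /L mulmxBl mulmxDl -!scalemxAl formDr formNr formDr !formZr.
    rewrite cce [form (c *m e) (b *m e)]form_sym bce mulr0 add0r /t.
    rewrite divfK ?subrr //.
    by rewrite !mulf_neq0.
have Lae : L *m (a *m e) = 0 by rewrite mulmxA La mulNmx -mulmxA Le mulmx0 oppr0.
(* Orthogonality to [e] and [a *m e] holds because [L] kills them, to [b *m e] because [L] is skew,
   and to [c *m e], which is [a *m (b *m e)], because [a *m L] is skew. *)
have Lbe : L *m (b *m e) = 0.
  apply: frame_orthogonal.
  - by rewrite form_skew // Le /form mulmx0 mxE oppr0.
  - by rewrite form_skew // Lae /form mulmx0 mxE oppr0.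
  - by rewrite form_sym form_skew_diag.
  - rewrite form_sym -ab -mulmxA form_skew // mulmxA form_skew_diag ?oppr0 //.
apply: frame_eq0 => //.
by rewrite -ab -mulmxA mulmxA La mulNmx -mulmxA Lbe mulmx0 oppr0.
Qed.

End SkewEndomorphisms.

(** * Imaginary split quaternions and their derivations *)

Section SplitQuaternions.
Variables (R : realType) (a b c : 'M[R]_4).
Hypotheses (aa : a *m a = - 1%:M) (bb : b *m b = 1%:M).
Hypotheses (ab : a *m b = c) (ba : b *m a = - c).
Implicit Types y z t : 'cV[R]_3.

Definition split_comb (a b c : 'M[R]_4) y : 'M[R]_4 :=
  y 0 0 *: a + y 1 0 *: b + y 2 0 *: c.

Let ac : a *m c = - b. Proof. by rewrite -ab mulmxA aa mulNmx mul1mx. Qed.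
Let ca : c *m a = b.
Proof. by rewrite -[c]opprK -ba mulNmx -mulmxA aa mulmxN mulmx1 opprK. Qed.
Let bc : b *m c = - a.
Proof. by rewrite -[c]opprK -ba mulmxN mulmxA bb mul1mx. Qed.
Let cb : c *m b = a. Proof. by rewrite -ab -mulmxA bb mulmx1. Qed.
Let cc : c *m c = 1%:M.
Proof. by rewrite -{1}ab -mulmxA bc mulmxN aa opprK. Qed.

Lemma split_combD y z : split_comb a b c (y + z) =
  split_comb a b c y + split_comb a b c z.
Proof.
by apply/matrixP => i j; rewrite !mxE; ring.
Qed.

Lemma split_combZ k y : split_comb a b c (k *: y) = k *: split_comb a b c y.
Proof. by apply/matrixP => i j; rewrite !mxE; ring. Qed.

(** Multiplication of imaginary split quaternions, split into real and imaginary part. *)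
Lemma split_comb_mul y z : split_comb a b c y *m split_comb a b c z =
  (inner3 y z)%:M + split_comb a b c (cross3 y z).
Proof.
rewrite /split_comb !mulmxDl !mulmxDr -!scalemxAl -!scalemxAr !scalerA.
rewrite aa bb cc ab ba ac ca bc cb /inner3 /cross3 !mxE /=.
rewrite -[(_ + _ + _)%:M]scalemx1.
apply/matrixP => i j; rewrite !mxE.
by move: (a i j) (b i j) (c i j) ((i == j)%:R) => x1 x2 x3 x4; ring.
Qed.

(** The anticommutator with any [z] is twice [inner3 y z], since [cross3] is antisymmetric. A zero
    combination therefore puts [y] in the radical of [inner3], which is trivial. *)
Lemma split_comb_eq0 y : split_comb a b c y = 0 -> y = 0.
Proof.
move=> y0.
have anti z : inner3 y z = 0.
  have := split_comb_mul y z; have := split_comb_mul z y.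
  rewrite y0 mulmx0 mul0mx => E1 E2.
  have : (inner3 z y)%:M + (inner3 y z)%:M = 0 :> 'M[R]_4.
    have crossN : cross3 z y = - cross3 y z.
      by apply/colP => i; rewrite !mxE; case: i => [[|[|[|//]]] ?] /=; ring.
    move: E1; rewrite crossN -[- cross3 y z]scaleN1r split_combZ scaleN1r => E1.
    by have := f_equal2 +%R E1 E2; rewrite addr0 addrACA addNr addr0 => <-.
  move=> /matrixP/(_ 0 0); rewrite !mxE eqxx !mulr1n.
  have -> : inner3 z y = inner3 y z by rewrite /inner3; ring.
  by move=> /eqP; rewrite -mulr2n mulrn_eq0 => /eqP.
apply/colP => i; rewrite mxE.
have := anti (delta_mx i 0); rewrite /inner3 !mxE.
case: i => [[|[|[|//]]] ?] /=; rewrite ?mulr1 ?mulr0 ?addr0 ?add0r ?oppr0.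
- by move=> /eqP; rewrite oppr_eq0 => /eqP <-; congr (y _ _); apply/val_inj.
- by move=> <-; rewrite ?add0r; congr (y _ _); apply/val_inj.
- by move=> <-; rewrite ?add0r; congr (y _ _); apply/val_inj.
Qed.

Lemma split_comb_inj y z : split_comb a b c y = split_comb a b c z -> y = z.
Proof.
move=> yz; apply/eqP; rewrite -subr_eq0; apply/eqP/split_comb_eq0.
by rewrite -scaleN1r split_combD split_combZ scaleN1r yz subrr.
Qed.

Lemma split_comb_sqr y : hyperboloid y ->
  split_comb a b c y *m split_comb a b c y = - 1%:M.
Proof.
move=> yH; rewrite split_comb_mul.
have -> : cross3 y y = 0.
  by apply/colP => i; rewrite !mxE; case: i => [[|[|[|//]]] ?] /=; ring.
have -> : inner3 y y = -1.
  by move: yH; rewrite /hyperboloid /inner3 /= => <-; ring.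
by rewrite /split_comb !mxE !scale0r !addr0 raddfN.
Qed.

Variables (g : 'M[R]_4) (e : 'cV[R]_4).
Hypotheses (g_sym : g^T = g) (g_unit : g \in unitmx).
Hypotheses (sa : skew g a) (sb : skew g b) (e_nonnull : form g e e != 0).

(* The values at one vector of the covariant derivatives of a, b and c = a b are
   the commutators with an imaginary split quaternion. *)
Lemma derivation_cross (K1 K2 K3 : 'M[R]_4) :
    skew g K1 -> skew g K2 ->
    K1 *m a = - (a *m K1) -> K2 *m b = - (b *m K2) -> K3 *m c = - (c *m K3) ->
    K3 = K1 *m b + a *m K2 ->
  exists t, forall y, split_comb K1 K2 K3 y = split_comb a b c (cross3 t y).
Proof.
move=> s1 s2 K1a K2b K3c K3E.
have one0 : (1 : R) != 0 by exact: oner_neq0.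
have m10 : (-1 : R) != 0 by rewrite oppr_eq0 oner_neq0.
have aa' : a *m a = (-1)%:M by rewrite aa raddfN.
have ba' : b *m a = - c by [].
have nab : b *m a = - (a *m b) by rewrite ab ba.
have [t3 [t2 E1]] := skew_anticommuting_span g_sym g_unit m10 one0 aa' bb ab ba
  sa sb e_nonnull s1 K1a.
have ab' : a *m b = - (b *m a) by rewrite ba opprK ab.
have [t3' [t1 E2]] := skew_anticommuting_span g_sym g_unit one0 m10 bb aa'
  (erefl _) ab' sb sa e_nonnull s2 K2b.
rewrite ba in E2.
have E3 : K3 = (t3 - t3') *: 1%:M + t2 *: a + t1 *: b.
  rewrite K3E E1 E2 mulmxDl mulmxDr -!scalemxAl -!scalemxAr mulmxN.
  rewrite aa bb cb ac opprK.
  by apply/matrixP => i j; rewrite !mxE; ring.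
(* The Leibniz rule leaves a scalar part in [K3]. It commutes with [c] while [a] and [b] anticommute
   with it, so [K3c] forces it to vanish. *)
have tE : t3 = t3'.
  move: K3c; rewrite E3 !mulmxDl !mulmxDr -!scalemxAl -!scalemxAr.
  rewrite mul1mx mulmx1 ac bc ca cb => E.
  have {E} : ((t3 - t3') *+ 2) *: c = 0.
    apply/matrixP => i j; have /matrixP/(_ i j) := E; rewrite !mxE.
    by move: (a i j) (b i j) (c i j) => x1 x2 x3; lra.
  move=> E; have : split_comb a b c (((t3 - t3') *+ 2) *: delta_mx 2 0) = 0.
    by rewrite split_combZ /split_comb !mxE /= !scale0r !add0r scale1r.
  move=> /split_comb_eq0/colP/(_ 2); rewrite !mxE /= mulr1 => /eqP.
  by rewrite mulrn_eq0 /= subr_eq0 => /eqP.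
exists (\col_i [:: - t1; - t2; t3]`_i) => y.
rewrite /split_comb E1 E2 E3 -tE /cross3.
by apply/matrixP => i j; rewrite !mxE /=; ring.
Qed.

End SplitQuaternions.

Lemma split_comb_linear (R : realType) (x0 x1 x2 : R)
    (k1 k2 k3 k4 k5 k6 k7 k8 k9 : 'M[R]_4) y :
  split_comb (x0 *: k1 + x1 *: k2 + x2 *: k3) (x0 *: k4 + x1 *: k5 + x2 *: k6)
    (x0 *: k7 + x1 *: k8 + x2 *: k9) y =
  x0 *: split_comb k1 k4 k7 y + x1 *: split_comb k2 k5 k8 y
  + x2 *: split_comb k3 k6 k9 y.
Proof. by apply/matrixP => i j; rewrite !mxE; ring. Qed.

Lemma inner3_cross3 (R : realType) (y z : 'cV[R]_3) : inner3 y (cross3 z y) = 0.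
Proof. by rewrite /inner3 !mxE /=; ring. Qed.

(* [t], [p], [q], [r] are the connection forms at v, J1 v, J2 v, J3 v, in the
   sense of [derivation_cross].  The hypotheses express integrability of J1 at
   v and J3 v, of J2 at v and J3 v, and of J3 at v. *)
Lemma integrable_cross (R : realType) (t p q r y : 'cV[R]_3) :
    let e i : 'cV[R]_3 := delta_mx i 0 in
    cross3 p (e 0) = cross3 (e 0) (cross3 t (e 0)) ->
    cross3 q (e 1) = cross3 (e 1) (cross3 t (e 1)) ->
    cross3 r (e 2) = cross3 (e 2) (cross3 t (e 2)) ->
    - cross3 p (e 1) = cross3 (e 1) (cross3 r (e 1)) ->
    - cross3 q (e 0) = cross3 (e 0) (cross3 r (e 0)) ->
  cross3 (y 0 0 *: p + y 1 0 *: q + y 2 0 *: r) y = cross3 y (cross3 t y).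
Proof.
move=> e; rewrite {}/e => H1 H2 H3 H4 H5.
pose entry i (z : 'cV[R]_3) := z i 0.
have E1 : p 2 0 = t 1 0.
  by have := f_equal (entry 1) H1; rewrite /entry /cross3 !mxE /=; lra.
have E2 : p 1 0 = - t 2 0.
  by have := f_equal (entry 2) H1; rewrite /entry /cross3 !mxE /=; lra.
have E3 : q 2 0 = - t 0 0.
  by have := f_equal (entry 0) H2; rewrite /entry /cross3 !mxE /=; lra.
have E4 : q 0 0 = - t 2 0.
  by have := f_equal (entry 2) H2; rewrite /entry /cross3 !mxE /=; lra.
have E5 : r 1 0 = t 0 0.
  by have := f_equal (entry 0) H3; rewrite /entry /cross3 !mxE /=; lra.
have E6 : r 0 0 = t 1 0.
  by have := f_equal (entry 1) H3; rewrite /entry /cross3 !mxE /=; lra.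
(* The common value of [p 0 0], [q 1 0] and [r 2 0] stays undetermined, but it contributes only a
   multiple of [y], which [cross3] with [y] kills. *)
have E7 : p 0 0 = r 2 0.
  by have := f_equal (entry 2) H4; rewrite /entry /cross3 !mxE /=; lra.
have E8 : q 1 0 = r 2 0.
  by have := f_equal (entry 2) H5; rewrite /entry /cross3 !mxE /=; lra.
apply/colP => i; rewrite /cross3 !mxE /=.
rewrite E1 E2 E3 E4 E5 E6 E7 E8.
by case: i => [[|[|[|//]]] ?] /=; ring.
Qed.

(** * Charts and connections *)

(* [coord] is shadowed by the coordinates of a vector in a basis. *)
Local Notation coord := Defs.coord.

Section Charts.
Variables (R : realType) (M : topologicalType) (X : manifold4 R M).
Implicit Types i j : chart X.

Lemma paramK i u : img i u -> dom i (param i u) /\ coord i (param i u) = u.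
Proof. by move=> [x xi <-]; rewrite coordK. Qed.

Lemma coord_img i x : dom i x -> img i (coord i x).
Proof. by move=> xi; exists x. Qed.

Lemma img_is_open i : open (img i).
Proof. exact: img_open. Qed.

Lemma near_overlap i j u : img i u -> dom j (param i u) ->
  \forall w \near u, img i w /\ dom j (param i w).
Proof.
move=> ui uj.
have n1 : nbhs u (img i).
  by apply: open_nbhs_nbhs; split=> //; exact: img_is_open.
have n2 : nbhs u [set w | dom j (param i w)].
  apply: (param_continuous ui).
  by apply: open_nbhs_nbhs; split=> //; exact: dom_open.
exact: filterI n1 n2.
Qed.

Lemma overlap_open i j : open (coord i @` (dom i `&` dom j)).
Proof.
rewrite openE => _ [x [xi xj] <-] /=.
have ui := coord_img xi.
have uj : dom j (param i (coord i x)) by rewrite coordK.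
apply: filterS (near_overlap ui uj) => w [wi wj].
by have [? E] := paramK wi; exists (param i w).
Qed.

Lemma jac_transition i j x : dom i x -> dom j x ->
  jac (fun w => coord i (param j w)) (coord j x) *m
  jac (fun w => coord j (param i w)) (coord i x) = 1%:M.
Proof.
move=> xi xj; set sigma := fun w => _; set tau := fun w => _.
have oi := @overlap_open i j; have oj := @overlap_open j i.
have ui : (coord i @` (dom i `&` dom j)) (coord i x) by exists x.
have tau_x : tau (coord i x) = coord j x by rewrite /tau coordK.
have uj : (coord j @` (dom j `&` dom i)) (tau (coord i x)).
  by rewrite tau_x; exists x.
have stau : smooth_on (coord i @` (dom i `&` dom j)) tau.
  exact: transition_smooth.
have ssigma : smooth_on (coord j @` (dom j `&` dom i)) sigma.
  exact: transition_smooth.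
apply/matrixP => k l.
have dt : derivable tau (coord i x) (delta_mx l 0).
  exact: smooth_on_derivable stau ui.
have ss := smooth_on_mx k 0 oj ssigma.
have E : 'D_(delta_mx l 0) (fun w => sigma (tau w) k 0) (coord i x) =
    (1%:M : 'M[R]_4) k l.
  rewrite (@near_eq_derive _ _ _ _ (fun w : 'cV[R]_4 => w k 0)); last first.
    have : nbhs (coord i x) (coord i @` (dom i `&` dom j)).
      exact: open_nbhs_nbhs.
    apply: filterS => _ [y [yi yj] <-].
    by rewrite /sigma /tau (coordK yi) (coordK yj).
  have di : derivable (fun w : 'cV[R]_4 => w) (coord i x) (delta_mx l 0).
    exact: derivable_id.
  by rewrite (derive_mxE k 0 di) derive_id !mxE eqxx andbT.
rewrite -E (derive_chain oj uj ss dt) (smooth_deriveE _ oj uj ss) mxE.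
apply: eq_bigr => p _; rewrite [X in X * _]mxE [X in _ * X]mxE mulrC.
congr (_ * _); rewrite -tau_x; apply/esym/derive_mxE.
exact: smooth_on_derivable ssigma uj.
Qed.

Lemma frame_change_unit i x : dom i x -> frame_change i x \in unitmx.
Proof.
move=> xi.
exact: proj1 (mulmx1_unit (jac_transition xi (chart_atP X x))).
Qed.

Lemma endo_rep_mulmx i A B u : img i u ->
  endo_rep i A u *m endo_rep i B u = endo_rep i (fun x => A x *m B x) u.
Proof.
move=> /paramK[ui _]; rewrite /endo_rep.
rewrite !mulmxA -[_ *m invmx _ *m _]mulmxA.
by rewrite (mulVmx (frame_change_unit ui)) mulmx1.
Qed.

Lemma endo_rep_scalar i (k : R) u : img i u ->
  endo_rep i (fun=> k%:M) u = k%:M.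
Proof.
move=> /paramK[ui _]; rewrite /endo_rep mul_mx_scalar -scalemxAl.
by rewrite (mulmxV (frame_change_unit ui)) scalemx1.
Qed.

Lemma endo_repZ i k A u : endo_rep i (fun x => k *: A x) u = k *: endo_rep i A u.
Proof. by rewrite /endo_rep -scalemxAr -scalemxAl. Qed.

Lemma endo_repD i A B u :
  endo_rep i (fun x => A x + B x) u = endo_rep i A u + endo_rep i B u.
Proof. by rewrite /endo_rep mulmxDr mulmxDl. Qed.

Lemma endo_repN i A u : endo_rep i (fun x => - A x) u = - endo_rep i A u.
Proof. by rewrite /endo_rep mulmxN mulNmx. Qed.

Lemma form_rep_compat i G A u : img i u ->
  (endo_rep i A u)^T *m form_rep i G u *m endo_rep i A u =
  form_rep i (fun x => (A x)^T *m G x *m A x) u.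
Proof.
move=> /paramK[ui _]; have P := mulVmx (frame_change_unit ui).
rewrite /endo_rep /form_rep; move: P; set F := frame_change _ _ => P.
have PT : F^T *m (invmx F)^T = 1%:M by rewrite -trmx_mul P trmx1.
rewrite !trmx_mul !mulmxA -[_ *m F^T *m _]mulmxA PT mulmx1.
by rewrite -[_ *m invmx F *m F]mulmxA P mulmx1.
Qed.

Lemma form_rep_neutral i G u : img i u -> neutral_form (G (param i u)) ->
  [/\ (form_rep i G u)^T = form_rep i G u, form_rep i G u \in unitmx &
      exists e, form (form_rep i G u) e e != 0].
Proof.
move=> /paramK[ui _] [GT [P Pu PG]]; have Fu := frame_change_unit ui.
set F := frame_change _ _ in Fu.
have gP : (F *m P)^T *m form_rep i G u *m (F *m P) =
    diag_mx (\row_(a < 4) (if (a < 2)%N then 1 else -1)).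
  rewrite /form_rep -/F trmx_mul !mulmxA -[_ *m F^T *m _]mulmxA -trmx_mul.
  rewrite mulVmx // trmx1 mulmx1 -[_ *m invmx F *m F]mulmxA mulVmx // mulmx1.
  exact: PG.
split.
- by rewrite /form_rep !trmx_mul trmxK GT mulmxA.
- have : (F *m P)^T *m form_rep i G u *m (F *m P) \in unitmx.
    rewrite gP unitmxE det_diag unitfE; apply/prodf_neq0 => k _; rewrite mxE.
    by case: ifP; rewrite ?oppr_eq0 oner_neq0.
  by rewrite unitmx_mul => /andP[]; rewrite unitmx_mul => /andP[].
(* The first vector of a pseudo-orthonormal frame has square 1. *)
pose d : 'cV[R]_4 := delta_mx 0 0; exists ((F *m P) *m d).
have -> : form (form_rep i G u) ((F *m P) *m d) ((F *m P) *m d) =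
    form ((F *m P)^T *m form_rep i G u *m (F *m P)) d d.
  by move: (F *m P) => Q; rewrite /form trmx_mul !mulmxA.
by rewrite gP /form /d trmx_delta -rowE -colE !mxE /= mulr1n oner_neq0.
Qed.

End Charts.

(** * Globalising the maximum principle *)

Section CompactManifold.
Variables (R : realType) (M : topologicalType) (X : manifold4 R M).
Hypotheses (M_compact : compact [set: M]) (M_connected : connected [set: M]).

Lemma chartwise_continuous (u : M -> R) :
  (forall i : chart X, smooth_on (img i) (fun z => u (param i z))) ->
  continuous u.
Proof.
move=> su x; pose i := chart_at X x.
have xi : dom i x by exact: chart_atP.
have cu : {for coord i x, continuous (fun z => u (param i z))}.
  exact: smooth_on_continuous (su i) (coord_img xi).
have c2 : (fun y => u (param i (coord i y))) @ x --> u (param i (coord i x)).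
  exact: continuous_comp (Defs.coord_continuous xi) cu.
rewrite (coordK xi) in c2.
apply: cvg_trans c2; apply: near_eq_cvg.
have : nbhs x (dom i) by apply: open_nbhs_nbhs; split=> //; exact: dom_open.
by apply: filterS => y yi; rewrite (coordK yi).
Qed.

Lemma cauchy_riemann_constant (u v : M -> R)
    (B : chart X -> 'cV[R]_4 -> 'M[R]_4) :
    (forall i : chart X, smooth_on (img i) (fun z => u (param i z))) ->
    (forall i : chart X, smooth_on (img i) (fun z => v (param i z))) ->
    (forall i : chart X, smooth_on (img i) (B i)) ->
    (forall (i : chart X) z, img i z -> B i z *m B i z = - 1%:M) ->
    (forall (i : chart X) z a, img i z ->
       'D_(B i z *m a) (fun z => u (param i z)) z =
       - 'D_a (fun z => v (param i z)) z) ->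
  forall x y, u x = u y.
Proof.
move=> su sv sB B2 CR x0 y0.
have cu := chartwise_continuous su.
have M0 : [set: M] !=set0 by exists x0.
have [xm _ xmax] := compact_EVT_max M0 M_compact (continuous_subspaceT cu).
have um x : u x <= u xm by apply: xmax; rewrite inE.
pose A := [set x | u x = u xm].
suff AT : A = [set: M].
  have uA x : u x = u xm by have : [set: M] x by []; rewrite -AT.
  by rewrite !uA.
apply: M_connected.
- by exists xm.
- exists A; last by rewrite setTI.
  rewrite openE => x Ax /=; pose i := chart_at X x.
  have xi : dom i x by exact: chart_atP.
  have uxi : u (param i (coord i x)) = u xm by rewrite (coordK xi).
  have near_max := maximum_locally_constant (@img_is_open _ _ X i) (su i) (sv i)
    (sB i) (B2 i) (CR i) (coord_img xi) (fun z _ => um (param i z)) uxi.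
  have := Defs.coord_continuous xi near_max.
  have : nbhs x (dom i) by apply: open_nbhs_nbhs; split=> //; exact: dom_open.
  by apply: filterS2 => y yi /=; rewrite (coordK yi).
- exists A; last by rewrite setTI.
  have -> : A = u @^-1` [set t | t = u xm] by [].
  by apply: preimage_closed => [x _|]; [exact: cu|exact: closed_eq].
Qed.

End CompactManifold.

(** For metric compatibility: adding the lowered Christoffel symbol to the one with [p] and [l]
    exchanged cancels everything but the derivative of g_pl in direction [m]. *)
Lemma koszul (R : realType) (D : 'I_4 -> 'M[R]_4) (x : R) m p l :
    (forall q s t, D q s t = D q t s) ->
  x * D m p l = 2^-1 * (x * (D m l p + D p l m - D l m p)
    + x * (D m p l + D l p m - D p m l)).
Proof.
by move=> sym; rewrite (sym m l p) (sym l m p) (sym p m l); field.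
Qed.

(** * The Levi-Civita connection in a chart *)

Section LeviCivita.
Variables (R : realType) (M : topologicalType) (X : manifold4 R M).
Variables (G : M -> 'M[R]_4) (i : chart X) (u : 'cV[R]_4).
Hypotheses (sG : smooth_form X G) (nG : forall x, neutral_form (G x)).
Hypothesis ui : img i u.

Let g := form_rep i G.
Let Gamma v := conn_form G i u v.
Let oi : open (img i) := @img_is_open R M X i.

Let g_sym z : img i z -> (g z)^T = g z.
Proof. by move=> zi; have [] := form_rep_neutral zi (nG (param i z)). Qed.

Let g_unit : g u \in unitmx.
Proof. by have [] := form_rep_neutral ui (nG (param i u)). Qed.

Let sg : smooth_on (img i) g. Proof. exact: sG. Qed.

Let dg v : derivable g u v.
Proof. exact: (smooth_on_derivable sg ui). Qed.

Let near_u : nbhs u (img i).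
Proof. exact: open_nbhs_nbhs. Qed.

Let Dg_sym v : ('D_v g u)^T = 'D_v g u.
Proof.
have [_ <-] := derivable_trmx (@dg v).
by apply: near_eq_derive; apply: filterS near_u => z; exact: g_sym.
Qed.

Let Dgs m := 'D_(delta_mx m 0) g u.

(** Twice the Christoffel symbols of the first kind, [m] being the direction. *)
Let lowered m : 'M[R]_4 :=
  \matrix_(p, l) (Dgs m p l + Dgs l p m - Dgs p m l).

Let GammaE v :
  Gamma v = 2^-1 *: \sum_m v m 0 *: (invmx (g u) *m lowered m).
Proof.
apply/matrixP => k l; rewrite !mxE summxE mulr_sumr; apply: eq_bigr => m _.
rewrite !mxE /christoffel mulrAC -mulrA; congr (_ * _).
congr (_ * _); apply: eq_bigr => p _.
by rewrite mxE.
Qed.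

Let lowered_sym m l k : lowered m k l = lowered l k m.
Proof.
rewrite !mxE [Dgs m k l + _]addrC; congr (_ - _).
by rewrite /Dgs -[in LHS]Dg_sym mxE.
Qed.

Lemma conn_formD v w : Gamma (v + w) = Gamma v + Gamma w.
Proof.
rewrite !GammaE -scalerDr -big_split; congr (_ *: _); apply: eq_bigr => m _.
by rewrite mxE scalerDl.
Qed.

Lemma conn_formZ k v : Gamma (k *: v) = k *: Gamma v.
Proof.
rewrite !GammaE scalerA mulrC -scalerA scaler_sumr; congr (_ *: _).
by apply: eq_bigr => m _; rewrite mxE scalerA.
Qed.

(** Torsion-freeness, from the symmetry of the Christoffel symbols. *)
Lemma conn_form_sym v w : Gamma v *m w = Gamma w *m v.
Proof.
have E v' w' : Gamma v' *m w' = 2^-1 *: (invmx (g u) *m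
    \col_k \sum_m \sum_l v' m 0 * lowered m k l * w' l 0).
  rewrite GammaE -scalemxAl mulmx_suml; congr (_ *: _).
  rewrite (_ : \col_k _ = \sum_m v' m 0 *: (lowered m *m w')); last first.
    apply/colP => k; rewrite mxE summxE; apply: eq_bigr => m _.
    by rewrite !mxE mulr_sumr; apply: eq_bigr => l _; rewrite mulrA.
  rewrite mulmx_sumr; apply: eq_bigr => m _.
  by rewrite -scalemxAl -scalemxAr mulmxA.
rewrite !E; congr (_ *: (_ *m _)); apply/colP => k; rewrite !mxE exchange_big.
apply: eq_bigr => l _; apply: eq_bigr => m _.
by rewrite lowered_sym mulrAC [RHS]mulrC mulrA.
Qed.

(** Parallelism of the metric. *)
Lemma conn_form_metric v : 'D_v g u = (Gamma v)^T *m g u + g u *m Gamma v.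
Proof.
have E : g u *m Gamma v = 2^-1 *: \sum_m v m 0 *: lowered m.
  rewrite GammaE -scalemxAr mulmx_sumr; congr (_ *: _); apply: eq_bigr => m _.
  by rewrite -scalemxAr mulmxA mulmxV // mul1mx.
have -> : (Gamma v)^T *m g u = (g u *m Gamma v)^T by rewrite trmx_mul g_sym.
rewrite E (smooth_mx_deriveE v oi ui sg) linearZ -scalerDr.
apply/matrixP => p l; rewrite !mxE !summxE -big_split mulr_sumr.
apply: eq_bigr => m _ /=; rewrite !mxE -/(Dgs m).
by apply: koszul => q s t; rewrite /Dgs -[in LHS]Dg_sym mxE.
Qed.

End LeviCivita.

(** * Covariant derivatives of endomorphism fields *)

Section CovariantDerivative.
Variables (R : realType) (U : set 'cV[R]_4) (u : 'cV[R]_4).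
Hypotheses (oU : open U) (Uu : U u).
Variable Gamma : 'cV[R]_4 -> 'M[R]_4.
Hypotheses (GammaD : forall v w, Gamma (v + w) = Gamma v + Gamma w).
Hypotheses (GammaZ : forall k v, Gamma (k *: v) = k *: Gamma v).
Hypothesis Gamma_sym : forall v w, Gamma v *m w = Gamma w *m v.
Implicit Types A B C : 'cV[R]_4 -> 'M[R]_4.

(** [cov_endo] at a fixed point, for an abstract connection form of which only linearity and
    torsion-freeness are kept. *)
Definition covd A v : 'M[R]_4 :=
  'D_v A u + (Gamma v *m A u - A u *m Gamma v).

Let near_u : nbhs u U.
Proof. exact: open_nbhs_nbhs. Qed.

Let covd_shuffle (a b p q r s : 'M[R]_4) :
  a + b + (p + q - (r + s)) = a + (p - r) + (b + (q - s)).
Proof. by apply/matrixP => i j; rewrite !mxE; ring. Qed.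

Let nijenhuis_shuffle (x1 x2 x3 x4 s p q : 'cV[R]_4) :
  x1 - x2 + x3 - x4 = 0 -> x1 - x4 + s - (p + q) = x2 - x3 + s - (q + p).
Proof.
move=> /colP E; apply/colP => i; have := E i; rewrite !mxE.
by move: (x1 i 0) (x2 i 0) (x3 i 0) (x4 i 0) => *; lra.
Qed.

Lemma covdDv A v w : smooth_on U A -> covd A (v + w) = covd A v + covd A w.
Proof.
move=> sA; rewrite /covd GammaD !(smooth_mx_deriveE _ oU Uu sA).
rewrite (_ : \sum_k (v + w) k 0 *: _ = \sum_k v k 0 *: 'D_(delta_mx k 0) A u +
  \sum_k w k 0 *: 'D_(delta_mx k 0) A u); last first.
  by rewrite -big_split; apply: eq_bigr => k _; rewrite mxE scalerDl.
by rewrite mulmxDl mulmxDr covd_shuffle.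
Qed.

Lemma covdZv A k v : smooth_on U A -> covd A (k *: v) = k *: covd A v.
Proof.
move=> sA; rewrite /covd GammaZ deriveZv; last exact: smooth_on_derivable sA Uu.
by rewrite -scalemxAl -scalemxAr -scalerBr -scalerDr.
Qed.

Lemma covdD A B v : smooth_on U A -> smooth_on U B ->
  covd (fun z => A z + B z) v = covd A v + covd B v.
Proof.
move=> sA sB; rewrite /covd (_ : (fun z => A z + B z) = A + B) //.
rewrite deriveD; first last.
- exact: smooth_on_derivable sB Uu.
- exact: smooth_on_derivable sA Uu.
by rewrite mulmxDr mulmxDl covd_shuffle.
Qed.

Lemma covdZ A k v : smooth_on U A -> covd (fun z => k *: A z) v = k *: covd A v.
Proof.
move=> sA; rewrite /covd (_ : (fun z => k *: A z) = k *: A) //.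
rewrite deriveZ; last exact: smooth_on_derivable sA Uu.
by rewrite -scalemxAl -scalemxAr -scalerBr -scalerDr.
Qed.

(** The commutator with [Gamma v] is a derivation of the matrix product. *)
Lemma covdM A B C v : smooth_on U A -> smooth_on U B ->
    (forall z, U z -> A z *m B z = C z) ->
  covd C v = covd A v *m B u + A u *m covd B v.
Proof.
move=> sA sB ABC; rewrite /covd.
have dA : derivable A u v by exact: smooth_on_derivable sA Uu.
have dB : derivable B u v by exact: smooth_on_derivable sB Uu.
have [_ E] := derivable_mulmx dA dB.
have -> : 'D_v C u = 'D_v A u *m B u + A u *m 'D_v B u.
  rewrite -E; apply: near_eq_derive; apply: filterS near_u => z Uz.
  by rewrite ABC.
rewrite -(ABC u Uu) !mulmxDl !mulmxDr !mulmxN !mulNmx !mulmxA.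
set a := 'D_v A u *m B u; set b := A u *m 'D_v B u.
set p := Gamma v *m A u *m B u; set q := A u *m Gamma v *m B u.
set r := A u *m B u *m Gamma v.
apply/matrixP => i j; rewrite !mxE.
by move: (a i j) (b i j) (p i j) (q i j) (r i j) => a1 b1 p1 q1 r1; ring.
Qed.

Lemma covd_scalar k v : covd (fun=> k%:M) v = 0.
Proof.
by rewrite /covd derive_cst mul_mx_scalar mul_scalar_mx subrr addr0.
Qed.

Lemma covd_anticommute A k v : smooth_on U A ->
    (forall z, U z -> A z *m A z = k%:M) ->
  covd A v *m A u = - (A u *m covd A v).
Proof.
move=> sA A2; have /esym/eqP := covdM v sA sA A2.
by rewrite covd_scalar addr_eq0 => /eqP.
Qed.

(** Constant fields commute, so on them the Nijenhuis tensor contains only first derivatives of [A].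
    Covariant derivatives may replace these, as the connection terms are symmetric in [Y] and [Z] by
    [Gamma_sym]. *)
Lemma covd_nijenhuis A k Y Z : smooth_on U A ->
    (forall z, U z -> A z *m A z = k%:M) ->
    nijenhuis A (cst Y) (cst Z) u = 0 ->
  (covd A (A u *m Y) - A u *m covd A Y) *m Z =
  (covd A (A u *m Z) - A u *m covd A Z) *m Y.
Proof.
move=> sA A2 N0.
have dA v : derivable A u v by exact: smooth_on_derivable sA Uu.
have DA v (W : 'cV[R]_4) : 'D_v (fun w => A w *m W) u = 'D_v A u *m W.
  by have [] := derivable_mulmxl W (@dA v).
have {N0} N : 'D_(A u *m Y) A u *m Z - 'D_(A u *m Z) A u *m Y
    + A u *m ('D_Z A u *m Y) - A u *m ('D_Y A u *m Z) = 0.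
  have L1 : lie_bracket (cst Y) (cst Z) u = 0.
    by rewrite /lie_bracket !derive_cst subr0.
  have L2 : lie_bracket (fun w => A w *m Y) (fun w => A w *m Z) u =
      'D_(A u *m Y) A u *m Z - 'D_(A u *m Z) A u *m Y.
    by rewrite /lie_bracket !DA.
  have L3 : lie_bracket (fun w => A w *m Y) (cst Z) u = - ('D_Z A u *m Y).
    by rewrite /lie_bracket derive_cst DA sub0r.
  have L4 : lie_bracket (cst Y) (fun w => A w *m Z) u = 'D_Y A u *m Z.
    by rewrite /lie_bracket derive_cst DA subr0.
  move: N0; rewrite /nijenhuis /= L1 L2 L3 L4.
  by rewrite !mulmx0 add0r mulmxN opprK.
have E (P Q : 'cV[R]_4) : (covd A (A u *m P) - A u *m covd A P) *m Q =
    'D_(A u *m P) A u *m Q - A u *m ('D_P A u *m Q)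
    + (Gamma (A u *m P) *m (A u *m Q) + A u *m (A u *m (Gamma P *m Q)))
    - (A u *m (Gamma (A u *m P) *m Q) + A u *m (Gamma P *m (A u *m Q))).
  rewrite /covd mulmxBl mulmxDr mulmxBr !mulmxDl !mulNmx !mulmxA.
  set x1 := _ *m Q; set x2 := _ *m Q; set x3 := _ *m Q; set x4 := _ *m Q.
  set x5 := _ *m Q; set x6 := _ *m Q.
  apply/colP => i; rewrite !mxE.
  by move: (x1 i 0) (x2 i 0) (x3 i 0) (x4 i 0) (x5 i 0) (x6 i 0) => *; ring.
rewrite !E (Gamma_sym (A u *m Z) (A u *m Y)) (Gamma_sym Z Y).
rewrite (Gamma_sym (A u *m Z) Y) (Gamma_sym Z (A u *m Y)).
exact: nijenhuis_shuffle N.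
Qed.

(** Covariant differentiation of the skewness relation, the metric being parallel along [v]. *)
Lemma covd_skew (g : 'cV[R]_4 -> 'M[R]_4) A v :
    smooth_on U g -> smooth_on U A ->
    'D_v g u = (Gamma v)^T *m g u + g u *m Gamma v ->
    (forall z, U z -> skew (g z) (A z)) ->
  skew (g u) (covd A v).
Proof.
move=> sg sA Dg skA.
have dg : derivable g u v by exact: smooth_on_derivable sg Uu.
have dA : derivable A u v by exact: smooth_on_derivable sA Uu.
have [dAT DAT] := derivable_trmx dA.
have [_ E1] := derivable_mulmx dAT dg; have [dgA E2] := derivable_mulmx dg dA.
have E : 'D_v (fun z => (A z)^T *m g z) u = - 'D_v (fun z => g z *m A z) u.
  rewrite -(deriveN dgA); apply: near_eq_derive.
  by apply: filterS near_u => z /skA.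
move: E; rewrite E1 E2 DAT Dg => E.
have skAu := skA u Uu; rewrite /skew in skAu *.
have -> : (covd A v)^T = ('D_v A u)^T + ((A u)^T *m (Gamma v)^T
    - (Gamma v)^T *m (A u)^T).
  by rewrite /covd linearD linearB /= !trmx_mul.
have F1 : (Gamma v)^T *m (A u)^T *m g u = - ((Gamma v)^T *m g u *m A u).
  by rewrite -mulmxA skAu mulmxN mulmxA.
have F2 : (A u)^T *m g u *m Gamma v = - (g u *m A u *m Gamma v).
  by rewrite skAu mulNmx.
move: E; rewrite /covd !mulmxDl !mulmxDr !mulNmx !mulmxN !mulmxA F1 F2.
set x1 := ('D_v A u)^T *m g u; set x2 := g u *m 'D_v A u.
set x3 := (A u)^T *m (Gamma v)^T *m g u; set x4 := g u *m A u *m Gamma v.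
set x5 := (Gamma v)^T *m g u *m A u; set x6 := g u *m Gamma v *m A u.
move=> /matrixP E; apply/matrixP => i j; have := E i j; rewrite !mxE.
by move: (x1 i j) (x2 i j) (x3 i j) (x4 i j) (x5 i j) (x6 i j) => *; lra.
Qed.

(* For an integrable structure, (D_{AY} A - A D_Y A) Z is symmetric in Y and Z;
   it is also skew in Z, hence it vanishes. *)
Lemma covd_integrable (g : 'cV[R]_4 -> 'M[R]_4) A k :
    smooth_on U g -> smooth_on U A ->
    (forall v, 'D_v g u = (Gamma v)^T *m g u + g u *m Gamma v) ->
    (g u)^T = g u -> g u \in unitmx ->
    (forall z, U z -> skew (g z) (A z)) ->
    (forall z, U z -> A z *m A z = k%:M) ->
    (forall Y Z, nijenhuis A (cst Y) (cst Z) u = 0) ->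
  forall v, covd A (A u *m v) = A u *m covd A v.
Proof.
move=> sg sA Dg g_sym g_unit skA A2 N v; apply/eqP; rewrite -subr_eq0; apply/eqP.
apply: (skew_symmetric_eq0 g_sym g_unit
  (N := fun y => covd A (A u *m y) - A u *m covd A y)) => [y|y z].
  have sk w := covd_skew sg sA (Dg w) skA.
  apply: skewB; first exact: sk.
  apply: skewM; [exact: skA|exact: sk|].
  by rewrite (covd_anticommute y sA A2) opprK.
exact: covd_nijenhuis sA A2 (N y z).
Qed.

End CovariantDerivative.

(** * The twistor space *)

Section Twistor.
Variables (R : realType) (M : topologicalType) (X : manifold4 R M).
Variable h : almost_hyperhermitian X.

Section AtAPoint.
Variables (i : chart X) (u : 'cV[R]_4).
Hypothesis ui : img i u.

Let oi : open (img i) := @img_is_open R M X i.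
Let g := form_rep i (metric h).
Let a := endo_rep i (J1 h).
Let b := endo_rep i (J2 h).
Let c := endo_rep i (J3 h).
Let K1 v := cov_endo (metric h) i (J1 h) u v.
Let K2 v := cov_endo (metric h) i (J2 h) u v.
Let K3 v := cov_endo (metric h) i (J3 h) u v.

Let sg : smooth_on (img i) g. Proof. exact: metric_smooth. Qed.
Let sa : smooth_on (img i) a. Proof. exact: J1_smooth. Qed.
Let sb : smooth_on (img i) b. Proof. exact: J2_smooth. Qed.
Let sc : smooth_on (img i) c. Proof. exact: J3_smooth. Qed.

Let rep_sqr A (k : R) z : (forall x, A x *m A x = k%:M) -> img i z ->
  endo_rep i A z *m endo_rep i A z = k%:M.
Proof.
move=> A2 zi; rewrite endo_rep_mulmx // -(endo_rep_scalar k zi).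
by congr (endo_rep i _ z); rewrite funeqE.
Qed.

Let aa z : img i z -> a z *m a z = (-1)%:M.
Proof. by apply: rep_sqr => x; rewrite J1_sqr raddfN. Qed.
Let bb z : img i z -> b z *m b z = 1%:M.
Proof. by apply: rep_sqr => x; rewrite J2_sqr. Qed.
Let cc z : img i z -> c z *m c z = 1%:M.
Proof. by apply: rep_sqr => x; rewrite J3_sqr. Qed.
Let ab z : img i z -> a z *m b z = c z.
Proof.
move=> zi; rewrite endo_rep_mulmx //; congr (endo_rep i _ z).
by rewrite funeqE => x; rewrite J12.
Qed.
Let ba z : img i z -> b z *m a z = - c z.
Proof.
move=> zi; rewrite endo_rep_mulmx // -endo_repN; congr (endo_rep i _ z).
by rewrite funeqE => x; rewrite -(J21 h x) opprK.
Qed.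

(** Multiply the compatibility relation by A on the right and use A^2 = -k; [k] is 1 for J1 and -1
    for J2 and J3. *)
Let rep_skew A (k : R) z : k != 0 -> img i z ->
    (forall x, (A x)^T *m metric h x *m A x = k *: metric h x) ->
    (forall x, A x *m A x = (- k)%:M) ->
  skew (g z) (endo_rep i A z).
Proof.
move=> k0 zi Ag A2.
have E : (endo_rep i A z)^T *m g z *m endo_rep i A z = k *: g z.
  rewrite form_rep_compat //.
  rewrite (_ : (fun x => _) = fun x => k *: metric h x); last by rewrite funeqE.
  by rewrite /form_rep -scalemxAr -scalemxAl.
have := f_equal (mulmx^~ (endo_rep i A z)) E.
rewrite /= -mulmxA (rep_sqr A2 zi) mul_mx_scalar scaleNr -scalemxAl => /eqP.
rewrite eqr_oppLR -scalerN => /eqP E2.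
exact: (scalerI k0 E2).
Qed.

Let skew_a z : img i z -> skew (g z) (a z).
Proof.
move=> zi; apply: (rep_skew (k := 1)) => // [|x|x]; first exact: oner_neq0.
  by rewrite J1_compat scale1r.
by rewrite J1_sqr raddfN.
Qed.
Let oppr1_neq0 : (-1 : R) != 0. Proof. by rewrite oppr_eq0 oner_neq0. Qed.
Let skew_b z : img i z -> skew (g z) (b z).
Proof.
move=> zi; apply: (rep_skew (k := -1)) => // x.
  by rewrite J2_compat scaleN1r.
by rewrite J2_sqr opprK.
Qed.
Let skew_c z : img i z -> skew (g z) (c z).
Proof.
move=> zi; apply: (rep_skew (k := -1)) => // x.
  by rewrite J3_compat scaleN1r.
by rewrite J3_sqr opprK.
Qed.

Let aau : a u *m a u = - 1%:M. Proof. by rewrite aa // raddfN. Qed.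

Lemma endo_rep_Jcomb y z :
  endo_rep i (Jcomb h y) z = split_comb (a z) (b z) (c z) y.
Proof. by rewrite /Jcomb !endo_repD !endo_repZ. Qed.

Lemma endo_rep_Jcomb_inj y z :
  endo_rep i (Jcomb h y) u = endo_rep i (Jcomb h z) u -> y = z.
Proof.
by rewrite !endo_rep_Jcomb; apply: (split_comb_inj aau (bb ui) (ab ui) (ba ui)).
Qed.

Lemma endo_rep_Jcomb_sqr y : hyperboloid y ->
  endo_rep i (Jcomb h y) u *m endo_rep i (Jcomb h y) u = - 1%:M.
Proof.
move=> yH; rewrite !endo_rep_Jcomb.
exact: (split_comb_sqr aau (bb ui) (ab ui) (ba ui) yH).
Qed.

Lemma smooth_Jcomb y : smooth_on (img i) (endo_rep i (Jcomb h y)).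
Proof.
have sZ (A : 'cV[R]_4 -> 'M[R]_4) (k : R) :
    smooth_on (img i) A -> smooth_on (img i) (k *: A).
  by move=> sA; exact: (@smooth_onZ _ _ _ _ A k oi sA).
have S := smooth_onD oi (smooth_onD oi (sZ a (y 0 0) sa) (sZ b (y 1 0) sb))
  (sZ c (y 2 0) sc).
by apply: eq_smooth_on oi _ S => z _; rewrite endo_rep_Jcomb.
Qed.

Lemma conn_coefE y v w :
  cov_endo (metric h) i (Jcomb h y) u v = endo_rep i (Jcomb h w) u ->
  conn_coef h i (u, y) v = w.
Proof.
move=> E; rewrite /conn_coef; apply: endo_rep_Jcomb_inj.
rewrite -[RHS]E; apply/esym.
by have := @getPex _ [set w | cov_endo (metric h) i (Jcomb h y) u v =
  endo_rep i (Jcomb h w) u] (ex_intro _ w E).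
Qed.

Let Gamma := conn_form (metric h) i u.
Let GammaD v w : Gamma (v + w) = Gamma v + Gamma w.
Proof. exact: conn_formD. Qed.
Let GammaZ k v : Gamma (k *: v) = k *: Gamma v.
Proof. exact: conn_formZ. Qed.

Lemma cov_endo_Jcomb y v : cov_endo (metric h) i (Jcomb h y) u v =
  split_comb (K1 v) (K2 v) (K3 v) y.
Proof.
rewrite -[LHS]/(covd u Gamma (endo_rep i (Jcomb h y)) v).
have -> : endo_rep i (Jcomb h y) =
    (fun z => (fun z => y 0 0 *: a z + y 1 0 *: b z) z + y 2 0 *: c z).
  by rewrite funeqE => z; rewrite endo_rep_Jcomb.
have sya : smooth_on (img i) (fun z => y 0 0 *: a z)
  by exact: (@smooth_onZ _ _ _ _ a (y 0 0) oi sa).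
have syb : smooth_on (img i) (fun z => y 1 0 *: b z)
  by exact: (@smooth_onZ _ _ _ _ b (y 1 0) oi sb).
have syc : smooth_on (img i) (fun z => y 2 0 *: c z)
  by exact: (@smooth_onZ _ _ _ _ c (y 2 0) oi sc).
rewrite (covdD ui Gamma v (smooth_onD oi sya syb) syc).
rewrite (covdD ui Gamma v sya syb).
rewrite (covdZ ui Gamma _ v sa) (covdZ ui Gamma _ v sb).
by rewrite (covdZ ui Gamma _ v sc).
Qed.

Let Dg v : 'D_v g u = (Gamma v)^T *m g u + g u *m Gamma v.
Proof. exact: conn_form_metric (metric_smooth h) (metric_neutral h) ui v. Qed.

(** This is why D preserves E: there it acts as the commutator with an imaginary split quaternion.
    It also guarantees that the set chosen from in [conn_coef] is inhabited. *)
Lemma conn_form_exists v : exists t, forall y,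
  split_comb (K1 v) (K2 v) (K3 v) y = split_comb (a u) (b u) (c u) (cross3 t y).
Proof.
have [g_sym g_unit [e e0]] := form_rep_neutral ui (metric_neutral h (param i u)).
have s1 : skew (g u) (K1 v) := covd_skew oi ui sg sa (Dg v) skew_a.
have s2 : skew (g u) (K2 v) := covd_skew oi ui sg sb (Dg v) skew_b.
have K1a : K1 v *m a u = - (a u *m K1 v) :=
  covd_anticommute oi ui Gamma v sa aa.
have K2b : K2 v *m b u = - (b u *m K2 v) :=
  covd_anticommute oi ui Gamma v sb bb.
have K3c : K3 v *m c u = - (c u *m K3 v) :=
  covd_anticommute oi ui Gamma v sc cc.
have K3E : K3 v = K1 v *m b u + a u *m K2 v := covdM oi ui Gamma v sa sb ab.
exact: (derivation_cross aau (bb ui) (ab ui) (ba ui) g_sym g_unit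
  (skew_a ui) (skew_b ui) e0 s1 s2 K1a K2b K3c K3E).
Qed.

Lemma conn_coef0 y : conn_coef h i (u, y) 0 = 0.
Proof.
apply: conn_coefE; rewrite cov_endo_Jcomb endo_rep_Jcomb.
have K0 A : smooth_on (img i) A -> covd u Gamma A 0 = 0.
  by move=> sA; rewrite -(scale0r 0) (covdZv ui GammaZ _ _ sA) scale0r.
rewrite /split_comb [K1 0](K0 _ sa) [K2 0](K0 _ sb) [K3 0](K0 _ sc).
by rewrite !scaler0 !mxE !scale0r.
Qed.

Lemma conn_coef_hyperkahler y v : hyperkahler h -> conn_coef h i (u, y) v = 0.
Proof.
move=> [_ [p1 p2 p3]]; apply: conn_coefE; rewrite cov_endo_Jcomb endo_rep_Jcomb.
rewrite /K1 /K2 /K3 p1 // p2 // p3 // /split_comb.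
by rewrite !scaler0 !mxE !scale0r.
Qed.

Lemma conn_coef_hyperhermitian y v : hyperhermitian h ->
  conn_coef h i (u, y) (endo_rep i (Jcomb h y) u *m v) =
  cross3 y (conn_coef h i (u, y) v).
Proof.
move=> [n1 n2 n3].
have [g_sym g_unit _] := form_rep_neutral ui (metric_neutral h (param i u)).
have Gamma_sym v1 v2 : Gamma v1 *m v2 = Gamma v2 *m v1.
  exact: conn_form_sym (metric_smooth h) (metric_neutral h) ui v1 v2.
have integ A k : integrable_endo X A -> smooth_on (img i) (endo_rep i A) ->
    (forall z, img i z -> skew (g z) (endo_rep i A z)) ->
    (forall z, img i z -> endo_rep i A z *m endo_rep i A z = k%:M) ->
    forall w, covd u Gamma (endo_rep i A) (endo_rep i A u *m w) =
      endo_rep i A u *m covd u Gamma (endo_rep i A) w.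
  move=> nA sA skA A2; apply: (covd_integrable oi ui Gamma_sym sg sA Dg g_sym
    g_unit skA A2) => Y Z.
  by apply: nA => //; exact: smooth_on_cst.
have I1 w : K1 (a u *m w) = a u *m K1 w by exact: integ n1 sa skew_a aa w.
have I2 w : K2 (b u *m w) = b u *m K2 w by exact: integ n2 sb skew_b bb w.
have I3 w : K3 (c u *m w) = c u *m K3 w by exact: integ n3 sc skew_c cc w.
pose e k : 'cV[R]_3 := delta_mx k 0.
pose S := split_comb (a u) (b u) (c u).
have Sinj y1 y2 : S y1 = S y2 -> y1 = y2.
  exact: split_comb_inj aau (bb ui) (ab ui) (ba ui) y1 y2.
have S0 : S (e 0) = a u.
  by rewrite /S /split_comb !mxE /= scale1r !scale0r !addr0.
have S1 : S (e 1) = b u.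
  by rewrite /S /split_comb !mxE /= scale1r !scale0r addr0 add0r.
have S2 : S (e 2) = c u.
  by rewrite /S /split_comb !mxE /= scale1r !scale0r !add0r.
have [t tP] := conn_form_exists v.
have [p pP] := conn_form_exists (a u *m v).
have [q qP] := conn_form_exists (b u *m v).
have [r rP] := conn_form_exists (c u *m v).
have K1E w : K1 w = split_comb (K1 w) (K2 w) (K3 w) (e 0).
  by rewrite /split_comb !mxE /= scale1r !scale0r !addr0.
have K2E w : K2 w = split_comb (K1 w) (K2 w) (K3 w) (e 1).
  by rewrite /split_comb !mxE /= scale1r !scale0r addr0 add0r.
have K3E w : K3 w = split_comb (K1 w) (K2 w) (K3 w) (e 2).
  by rewrite /split_comb !mxE /= scale1r !scale0r !add0r.
have SM z w : S z *m S (cross3 w z) = S (cross3 z (cross3 w z)).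
  rewrite /S (split_comb_mul aau (bb ui) (ab ui) (ba ui)) inner3_cross3.
  by rewrite raddf0 add0r.
have SN z : S (- z) = - S z by rewrite -scaleN1r /S split_combZ scaleN1r.
have KN A w : smooth_on (img i) A -> covd u Gamma A (- w) = - covd u Gamma A w.
  by move=> sA; rewrite -scaleN1r (covdZv ui GammaZ _ _ sA) scaleN1r.
have H1 : cross3 p (e 0) = cross3 (e 0) (cross3 t (e 0)).
  by apply: Sinj; rewrite -SM -/(S _) /S -pP -tP -K1E -K1E I1 -/S S0.
have H2 : cross3 q (e 1) = cross3 (e 1) (cross3 t (e 1)).
  by apply: Sinj; rewrite -SM -/(S _) /S -qP -tP -K2E -K2E I2 -/S S1.
have H3 : cross3 r (e 2) = cross3 (e 2) (cross3 t (e 2)).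
  by apply: Sinj; rewrite -SM -/(S _) /S -rP -tP -K3E -K3E I3 -/S S2.
(* By these identities, integrability of J2 and J1 taken at J3 v links the connection form [r] with
   [p] and with [q]. *)
have bcv : b u *m (c u *m v) = - (a u *m v).
  have bc : b u *m c u = - a u.
    by rewrite -[c u]opprK -(ba ui) mulmxN mulmxA (bb ui) mul1mx.
  by rewrite mulmxA bc mulNmx.
have acv : a u *m (c u *m v) = - (b u *m v).
  have ac : a u *m c u = - b u by rewrite -(ab ui) mulmxA aau mulNmx mul1mx.
  by rewrite mulmxA ac mulNmx.
have H4 : - cross3 p (e 1) = cross3 (e 1) (cross3 r (e 1)).
  apply: Sinj; rewrite -SM SN /S -pP -rP -K2E -K2E -/S S1 -I2 bcv.
  exact/esym/(KN _ _ sb).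
have H5 : - cross3 q (e 0) = cross3 (e 0) (cross3 r (e 0)).
  apply: Sinj; rewrite -SM SN /S -qP -rP -K1E -K1E -/S S0 -I1 acv.
  exact/esym/(KN _ _ sa).
have H := integrable_cross y H1 H2 H3 H4 H5.
have -> : conn_coef h i (u, y) v = cross3 t y.
  by apply: conn_coefE; rewrite cov_endo_Jcomb endo_rep_Jcomb tP.
apply: conn_coefE; rewrite -H cov_endo_Jcomb !endo_rep_Jcomb.
pose w := y 0 0 *: (a u *m v) + y 1 0 *: (b u *m v) + y 2 0 *: (c u *m v).
have -> : split_comb (a u) (b u) (c u) y *m v = w.
  by rewrite /split_comb !mulmxDl -!scalemxAl.
have Kw A : smooth_on (img i) A -> covd u Gamma A w =
    y 0 0 *: covd u Gamma A (a u *m v) + y 1 0 *: covd u Gamma A (b u *m v)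
    + y 2 0 *: covd u Gamma A (c u *m v).
  move=> sA; rewrite /w !(covdDv oi ui GammaD _ _ sA).
  by rewrite !(covdZv ui GammaZ _ _ sA).
rewrite [K1 w](Kw _ sa) [K2 w](Kw _ sb) [K3 w](Kw _ sc).
have -> : cross3 (y 0 0 *: p + y 1 0 *: q + y 2 0 *: r) y =
    y 0 0 *: cross3 p y + y 1 0 *: cross3 q y + y 2 0 *: cross3 r y.
  by apply/colP => k; rewrite !mxE; case: k => [[|[|[|//]]] ?] /=; ring.
rewrite !split_combD !split_combZ -pP -qP -rP.
exact: split_comb_linear.
Qed.

End AtAPoint.

End Twistor.

(** * Restriction to slices of a product *)

Lemma continuous_pairr (S T : topologicalType) (x : S) :
  continuous (fun z : T => (x, z)).
Proof. by move=> z; exact: (cvg_pair (cvg_cst x) cvg_id). Qed.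

Lemma continuous_pairl (S T : topologicalType) (x : T) :
  continuous (fun z : S => (z, x)).
Proof. by move=> z; exact: (cvg_pair cvg_id (cvg_cst x)). Qed.

Section Slices.
Variables (R : realType) (V V' : normedModType R).
Variables (g : V -> V') (l : V -> V').
Hypothesis gE : forall x v (k : R), g (k *: v + x) = k *: l v + g x.

Lemma deriveC_comp_affine (F : V' -> R[i]) x v :
  deriveC (fun z => F (g z)) x v = deriveC F (g x) (l v).
Proof.
have [E1 _] := @derive_comp_affine R V V' R^o (fun z => complex.Re (F z)) g x v
  (l v) (gE x v).
have [E2 _] := @derive_comp_affine R V V' R^o (fun z => complex.Im (F z)) g x v
  (l v) (gE x v).
by apply/eqP; rewrite eq_complex; apply/andP; split; apply/eqP;
  [exact: E1|exact: E2].
Qed.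

Lemma smoothC_on_comp_affine (U : set V') (F : V' -> R[i]) : continuous g ->
  smoothC_on U F -> smoothC_on (g @^-1` U) (fun z => F (g z)).
Proof.
move=> cg [s1 s2]; split.
  exact: (@smooth_on_comp_affine R V V' R^o U (fun z => complex.Re (F z)) g l
    gE cg s1).
exact: (@smooth_on_comp_affine R V V' R^o U (fun z => complex.Im (F z)) g l
  gE cg s2).
Qed.

End Slices.

Lemma deriveC_Nv (R : realType) (V : normedModType R) (U : set V)
    (F : V -> R[i]) x v :
  smoothC_on U F -> U x -> deriveC F x (- v) = - deriveC F x v.
Proof.
move=> [s1 s2] Ux.
have E1 := deriveNv (smooth_on_derivable (v := v) s1 Ux).
have E2 := deriveNv (smooth_on_derivable (v := v) s2 Ux).
by apply/eqP; rewrite eq_complex; apply/andP; split; apply/eqP;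
  [exact: E1|exact: E2].
Qed.

Lemma mul_i_Complex (R : realType) (p q p' q' : R) :
  (p' +i* q')%C = 'i%C * (p +i* q)%C -> p' = - q /\ q' = p.
Proof.
by case=> -> ->; rewrite !mul0r !mul1r sub0r add0r.
Qed.

(** * Holomorphic functions on the twistor space *)

Section Constancy.
Variables (R : realType) (M : topologicalType) (X : manifold4 R M).
Variable h : almost_hyperhermitian X.

Lemma twistor_J_vertical k i u y w : img i u ->
  twistor_J h k i (u, y) (0, w) = (0, (-1) ^+ k.-1 *: cross3 y w).
Proof.
move=> ui; rewrite /twistor_J /hlift /vpart /= mulmx0 conn_coef0 // oppr0 addr0.
by apply/pair_equal_spec; rewrite /= addr0 add0r.
Qed.

Lemma cross3_0 y : cross3 y 0 = 0 :> 'cV[R]_3.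
Proof. by apply/colP => j; rewrite !mxE; case: j => [[|[|[|//]]] ?] /=; ring. Qed.

(** The vector (v, 0) is tangent to the section with constant [y] and has vertical part w =
    [conn_coef h i (u, y) v]. The horizontal lift of J_y v contributes minus [cross3 y w], and J_1
    on the vertical part contributes plus [cross3 y w]. The sign in J_1 is the one that cancels;
    with that of J_2 the terms would add up. *)
Lemma twistor_J1_horizontal i u y v : hyperhermitian h -> img i u ->
  twistor_J h 1 i (u, y) (v, 0) = (endo_rep i (Jcomb h y) u *m v, 0).
Proof.
move=> hh ui; rewrite /twistor_J /hlift /vpart /= expr0 scale1r add0r.
by rewrite (conn_coef_hyperhermitian ui _ _ hh); apply/pair_equal_spec;
  rewrite /= addr0 addNr.
Qed.

Lemma twistor_J_horizontal k i u y v : hyperkahler h -> img i u ->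
  twistor_J h k i (u, y) (v, 0) = (endo_rep i (Jcomb h y) u *m v, 0).
Proof.
move=> hk ui; rewrite /twistor_J /hlift /vpart /=.
rewrite !(conn_coef_hyperkahler ui _ _ hk) oppr0 addr0 cross3_0 scaler0.
by apply/pair_equal_spec; rewrite /= !addr0.
Qed.

Lemma twistor_projE x y : hyperboloid y -> twistor_proj h (x, Jcomb h y x) = y.
Proof.
move=> yH; rewrite /twistor_proj.
have [] := @getPex _ [set z | hyperboloid z /\ (x, Jcomb h y x).2 =
  Jcomb h z (x, Jcomb h y x).1] (ex_intro _ y (conj yH erefl)).
move: (get _) => z _ /= E; apply/esym.
have ba : J2 h x *m J1 h x = - J3 h x by rewrite -(J21 h x) opprK.
exact: (split_comb_inj (J1_sqr h x) (J2_sqr h x) (J12 h x) ba E).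
Qed.

Variables (k : nat) (f : M * 'M[R]_4 -> R[i]).
Hypothesis f_holo : twistor_holomorphic h k f.

Lemma twistor_holomorphic_vertical (x : M) y : hyperboloid y ->
  exists (U : set 'cV[R]_3) F,
    [/\ open U, U y, smoothC_on U F,
        (forall z, U z -> hyperboloid z -> F z = f (x, Jcomb h z x)) &
        forall w, hyperboloid_tangent y w ->
          deriveC F y ((-1) ^+ k.-1 *: cross3 y w) = 'i%C * deriveC F y w].
Proof.
move=> yH; pose i := chart_at X x; pose u := coord i x.
have xi : dom i x := chart_atP X x.
have ui : img i u := coord_img xi.
have [|U [F [oU Uq sF FE dF]]] := @f_holo i (u, y) _; first by split.
pose g (z : 'cV[R]_3) := (u, z); pose l (z : 'cV[R]_3) := (0 : 'cV[R]_4, z).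
have gE z w (t : R) : g (t *: w + z) = t *: l w + g z.
  by apply/pair_equal_spec; rewrite /= scaler0 add0r.
have cg : continuous g.
  exact: continuous_pairr.
exists (g @^-1` U), (fun z => F (g z)); split.
- exact: (@open_comp _ _ g U (fun z _ => cg z) oU).
- exact: Uq.
- exact: (smoothC_on_comp_affine gE cg sF).
- move=> z Uz zH; rewrite (FE (g z) Uz); last by split.
  by rewrite /twistor_fun /= /u coordK.
- move=> w yw; rewrite !(deriveC_comp_affine gE).
  have := dF (l w) yw; rewrite (twistor_J_vertical k y w ui); exact: id.
Qed.

(** The common ground of both cases: sections with constant [y] are holomorphic from J_y to J_k. *)
Hypothesis horizontal : forall i u y v, img i u ->
  twistor_J h k i (u, y) (v, 0) = (endo_rep i (Jcomb h y) u *m v, 0).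

Lemma twistor_holomorphic_section (i : chart X) u y : img i u -> hyperboloid y ->
  exists (U : set 'cV[R]_4) F,
    [/\ open U, U u, smoothC_on U F,
        (forall z, U z -> F z = f (param i z, Jcomb h y (param i z))) &
        forall v, deriveC F u (endo_rep i (Jcomb h y) u *m v)
                  = 'i%C * deriveC F u v].
Proof.
move=> ui yH.
have [|U [F [oU Uq sF FE dF]]] := @f_holo i (u, y) _; first by split.
pose g (z : 'cV[R]_4) := (z, y); pose l (z : 'cV[R]_4) := (z, 0 : 'cV[R]_3).
have gE z w (t : R) : g (t *: w + z) = t *: l w + g z.
  by apply/pair_equal_spec; rewrite /= scaler0 add0r.
have cg : continuous g.
  exact: continuous_pairl.
exists (g @^-1` U `&` img i), (fun z => F (g z)); split.
- apply: openI; last exact: img_is_open.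
  exact: (@open_comp _ _ g U (fun z _ => cg z) oU).
- by split.
- have [s1 s2] := smoothC_on_comp_affine gE cg sF.
  by split; [apply: smooth_on_sub s1|apply: smooth_on_sub s2] => z [].
- by move=> z [Uz zi]; rewrite (FE (g z) Uz).
- move=> v; have := dF (l v) _.
  rewrite horizontal // !(deriveC_comp_affine gE); apply.
  by rewrite /twistor_tangent /inner3 /= !mxE !mulr0 oppr0 !addr0.
Qed.

Lemma twistor_holomorphic_fibre : compact [set: M] -> connected [set: M] ->
  forall y, hyperboloid y ->
  forall x x', f (x, Jcomb h y x) = f (x', Jcomb h y x').
Proof.
move=> cM cnM y yH.
pose u x := complex.Re (f (x, Jcomb h y x)).
pose v x := complex.Im (f (x, Jcomb h y x)).
pose B (i : chart X) := endo_rep i (Jcomb h y).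
have su (i : chart X) : smooth_on (img i) (fun z => u (param i z)).
  apply: smooth_on_local => z zi.
  have [U [F [oU Uz [sF _] FE _]]] := twistor_holomorphic_section zi yH.
  have E w : U w -> complex.Re (F w) = u (param i w).
    by move=> Uw; rewrite /u -FE.
  by exists U; [exact: conj oU Uz|exact: (eq_smooth_on oU E sF)].
have sv (i : chart X) : smooth_on (img i) (fun z => v (param i z)).
  apply: smooth_on_local => z zi.
  have [U [F [oU Uz [_ sF] FE _]]] := twistor_holomorphic_section zi yH.
  have E w : U w -> complex.Im (F w) = v (param i w).
    by move=> Uw; rewrite /v -FE.
  by exists U; [exact: conj oU Uz|exact: (eq_smooth_on oU E sF)].
have sB (i : chart X) : smooth_on (img i) (B i) by exact: smooth_Jcomb.
have B2 (i : chart X) z : img i z -> B i z *m B i z = - 1%:M.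
  by move=> zi; exact: endo_rep_Jcomb_sqr.
have CR (i : chart X) z a : img i z ->
    'D_(B i z *m a) (fun z => u (param i z)) z =
      - 'D_a (fun z => v (param i z)) z
    /\ 'D_(B i z *m a) (fun z => v (param i z)) z =
       'D_a (fun z => u (param i z)) z.
  move=> zi.
  have [U [F [oU Uz _ FE dF]]] := twistor_holomorphic_section zi yH.
  have nU : nbhs z U by exact: open_nbhs_nbhs.
  have uE w : 'D_w (fun z => u (param i z)) z =
      'D_w (fun z => complex.Re (F z)) z.
    by apply: near_eq_derive; apply: filterS nU => t Ut; rewrite /u -FE.
  have vE w : 'D_w (fun z => v (param i z)) z =
      'D_w (fun z => complex.Im (F z)) z.
    by apply: near_eq_derive; apply: filterS nU => t Ut; rewrite /v -FE.
  by rewrite !uE !vE; exact: mul_i_Complex (dF a).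
have CR1 (i : chart X) z a : img i z ->
    'D_(B i z *m a) (fun z => u (param i z)) z =
    - 'D_a (fun z => v (param i z)) z by move=> /(CR i z a)[].
(* The imaginary part of f is the real part of -i f, whose imaginary part is [- u]; so the pair [v],
   [- u] satisfies the same equations. *)
have sNu (i : chart X) : smooth_on (img i) (fun z => - u (param i z)).
  have E : (-1) *: (fun z => u (param i z)) = (fun z => - u (param i z)).
    by rewrite funeqE => z; exact: mulN1r.
  rewrite -E.
  exact: (@smooth_onZ _ _ _ _ _ (-1) (@img_is_open _ _ X i) (su i)).
have CR2 (i : chart X) z a : img i z ->
    'D_(B i z *m a) (fun z => v (param i z)) z =
    - 'D_a (fun z => - u (param i z)) z.
  move=> zi; have [_ ->] := CR i z a zi.
  have du := smooth_on_derivable (v := a) (su i) zi.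
  by rewrite [in RHS](deriveN du) opprK.
have uxy := cauchy_riemann_constant cM cnM su sv sB B2 CR1.
have vxy := @cauchy_riemann_constant R M X cM cnM v (fun x => - u x) B sv sNu sB
  B2 CR2.
move=> x x'; have := uxy x x'; have := vxy x x'; rewrite /u /v.
by case: (f _) => p q; case: (f _) => p' q' /= -> ->.
Qed.

(** The hypothesis on [c] moves the sign of J_k on vertical vectors into the scalar: [c] is i for k
    = 1 and -i for k = 2. *)
Lemma twistor_holomorphic_factor (c : R[i]) :
    compact [set: M] -> connected [set: M] ->
    (forall (V : normedModType R) (U : set V) (F : V -> R[i]) x v z,
      smoothC_on U F -> U x ->
      deriveC F x ((-1) ^+ k.-1 *: v) = 'i%C * z -> deriveC F x v = c * z) ->
  exists2 phi : 'cV[R]_3 -> R[i],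
    diff_scales_on c (@hyperboloid R) (@hyperboloid_tangent R) (@cross3 R) phi &
    forall s, twistor_space h s -> f s = phi (twistor_proj h s).
Proof.
move=> cM cnM cE.
(* An empty [M] counts as connected; there the zero function serves as [phi]. *)
have [x0|noM] := pselect (exists x : M, True); last first.
  exists (cst 0) => [y yH|[x s] _]; last by case: noM; exists x.
  exists setT, (cst 0); split => //; first exact: openT.
    by split; exact: smooth_on_cst.
  move=> v _; have E w : deriveC (cst 0 : 'cV[R]_3 -> R[i]) y w = 0.
    by rewrite /deriveC !derive_cst.
  by rewrite !E mulr0.
case: x0 => x0 _; exists (fun y => f (x0, Jcomb h y x0)).
  move=> y yH.
  have [U [F [oU Uy sF FE dF]]] := twistor_holomorphic_vertical x0 yH.
  exists U, F; split => // w yw.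
  exact: cE sF Uy (dF w yw).
move=> [x s] [y yH /= ->]; rewrite twistor_projE //.
exact: twistor_holomorphic_fibre.
Qed.

End Constancy.

Theorem corollary4 (R : realType) (M : topologicalType) (X : manifold4 R M)
    (h : almost_hyperhermitian X)
    (M_compact : compact [set: M]) (M_connected : connected [set: M])
    (h_hyperhermitian : hyperhermitian h) :
  (forall f : M * 'M[R]_4 -> R[i], twistor_holomorphic h 1 f ->
     exists2 phi : 'cV[R]_3 -> R[i], holomorphic_H phi &
       forall s, twistor_space h s -> f s = phi (twistor_proj h s)) /\
  (hyperkahler h ->
   forall f : M * 'M[R]_4 -> R[i], twistor_holomorphic h 2 f ->
     exists2 phi : 'cV[R]_3 -> R[i], antiholomorphic_H phi &
       forall s, twistor_space h s -> f s = phi (twistor_proj h s)).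
Proof.
split=> [f fh|hk f fh].
- apply: (twistor_holomorphic_factor fh) => //.
    by move=> i u y v; exact: twistor_J1_horizontal.
  by move=> V U F x v z _ _; rewrite expr0 scale1r.
- apply: (twistor_holomorphic_factor fh) => //.
    by move=> i u y v; exact: twistor_J_horizontal.
  move=> V U F x v z sF Ux; rewrite expr1 scaleN1r (deriveC_Nv _ sF Ux).
  by rewrite mulNr => <-; rewrite opprK.
Qed.
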